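(* Let $q\in[2,\infty)$, $L>0$, $c_1,c_2>0$, $\gamma\in C^{1,1}_{\mathrm{ia}}(\mathbb{R}/L\mathbb{Z},\mathbb{R}^3)$, $n_0\ge 2$, and let $(\mathcal{M}_n)_{n\ge n_0}$ with $\mathcal{M}_n=\{s_{n,0},\dots,s_{n,n}\}$ be a $(c_1-c_2)$-distributed sequence of partitions of $\mathbb{R}/L\mathbb{Z}$. Let $(\beta_n)_{n\ge n_0}$, with $\beta_n\in\tilde{\mathcal{B}}_n$, be a sequence of proper $\gamma$-interpolating and balanced biarc curves, $\beta_n$ interpolating the point-tangent data $$\big(([\gamma(s_{n,i}),\gamma'(s_{n,i})],[\gamma(s_{n,i+1}),\gamma'(s_{n,i+1})])\big)_{i=0,\dots,n-1}.$$ Then there exists $N\in\mathbb{N}$ such that for every $\varepsilon>0$ there is a constant $C_\varepsilon>0$ with $$\big|\mathrm{TP}_q(\gamma)-\tilde{\mathcal{E}}_q^n(\beta_n)\big|\le\frac{C_\varepsilon}{n^{1-\varepsilon}}\qquad\text{for all } n\ge N .$$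
   Context: $C^{1,1}_{\mathrm{ia}}(\mathbb{R}/L\mathbb{Z},\mathbb{R}^3)$ is the set of closed $C^{1,1}$-curves $\gamma:\mathbb{R}/L\mathbb{Z}\to\mathbb{R}^3$ that are injective and parametrized by arclength ($|\gamma'|\equiv1$). $(c_1-c_2)$-distributed: $0=s_{n,0}<s_{n,1}<\dots<s_{n,n}=L$, and with $h_n=\max_{k}|s_{n,k+1}-s_{n,k}|$, $\tilde h_n=\min_k|s_{n,k+1}-s_{n,k}|$ ($k=0,\dots,n-1$) one has $\frac{c_1}{n}\le\tilde h_n\le h_n\le\frac{c_2}{n}$ and $h_n\le\frac L2$ for all $n$ in the index range. Tangent-point energy: $$\mathrm{TP}_q(\gamma)=\iint_{(\mathbb{R}/L\mathbb{Z})^2}\left(\frac{2\,\mathrm{dist}(\gamma(s)+\mathbb{R}\gamma'(s),\gamma(t))}{|\gamma(s)-\gamma(t)|^2}\right)^q ds\,dt.$$ Biarcs: a point-tangent pair is $([q_0,t_0],[q_1,t_1])$ with $q_0\neq q_1\in\mathbb{R}^3$ and $t_0,t_1\in\mathbb{S}^2$. A biarc interpolating it is a pair of circular arcs $(a,\bar a)$ in $\mathbb{R}^3$ (straight segments allowed as degenerate arcs) joined continuously with continuous tangent at a common end point $m$ (the matching point), running from $q_0$ with tangent $t_0$ to $q_1$ with tangent $t_1$, with orientation ($t_0$ points to the interior of $a$, $-t_1$ to the interior of $\bar a$). The pair is proper if $\langle q_1-q_0,t_0\rangle>0$ and $\langle q_1-q_0,t_1\rangle>0$. With $e=\frac{q_1-q_0}{|q_1-q_0|}$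 and $t_1^*=2\langle e,t_1\rangle e-t_1$, the pair is incompatible cocircular iff $t_0+t_1^*=0$. Otherwise let $\mathcal{C}_+$ be the circle (or straight line, if degenerate) through $q_0,q_1$ with tangent $t_0+t_1^*$ at $q_0$; the set of all possible matching points is $\Sigma_+=\mathcal{C}_+\setminus\{q_0,q_1\}$, and $\Sigma_{++}\subset\Sigma_+$ is the subarc from $q_0$ to $q_1$ in the orientation induced by $t_0+t_1^*$ at $q_0$. A biarc is proper if it interpolates a proper point-tangent pair with matching point $m\in\Sigma_{++}$. A biarc is $\gamma$-interpolating and balanced if it interpolates a pair $([\gamma(s),\gamma'(s)],[\gamma(s+h),\gamma'(s+h)])$, $h>0$, with matching point $m\in\Sigma_{++}$ satisfying $|m-\gamma(s)|=|\gamma(s+h)-m|$. $\tilde{\mathcal{B}}_n$ is the set of closed biarc curves, i.e. closed curves assembled in a $C^1$-fashion from $n$ consecutive biarcs interpolating point-tangent data $[q_0,t_0],\dots,[q_n,t_n]$ with $[q_n,t_n]=[q_0,t_0]$, the $i$-th biarc having length $\lambda_i$. A biarc curve is proper (resp. $\gamma$-interpolating and balanced) if each of its biarcs is. Discrete energy: for $\beta\in\tilde{\mathcal{B}}_n$ whose $n$ consecutive biarcs interpolate the point-tangent data $[q_0,t_0],\dots,[q_n,t_n]$ with $[q_n,t_n]=[q_0,t_0]$ and have lengths $\lambda_0,\dots,\lambda_{n-1}$ (the $i$-th biarc, of length $\lambda_i$, running from $q_i$ to $q_{i+1}$), $$\tilde{\mathcal{E}}_q^n(\beta)=\sum_{i=0}^{n-1}\sum_{j=0,\,j\ne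 i}^{n-1}\left(\frac{2\,\mathrm{dist}(q_j+\mathbb{R}t_j,q_i)}{|q_i-q_j|^2}\right)^q\lambda_i\lambda_j .$$ *)

(* Defs.v *)
From mathcomp Require Import all_boot all_order all_algebra.
From mathcomp Require Import all_classical all_reals all_analysis.

Set Implicit Arguments.
Unset Strict Implicit.
Unset Printing Implicit Defensive.

Import Order.TTheory GRing.Theory Num.Theory.
Import numFieldNormedType.Exports.

Local Open Scope classical_set_scope.
Local Open Scope ring_scope.

(* The library norm of 'rV[R]_3 is the sup norm.  It is used below only through
   the topology, i.e. for derivatives; every metric quantity is Euclidean. *)
Definition edot (R : realType) (u v : 'rV[R]_3) : R :=
  \sum_(i < 3) u ord0 i * v ord0 i.

Definition enorm (R : realType) (u : 'rV[R]_3) : R := Num.sqrt (edot u u).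

(** * Curves and partitions *)

(* Functions on R/LZ are represented by L-periodic functions on R. *)
Definition closed_C11_ia (R : realType) (L : R) (gamma : R -> 'rV[R]_3) : Prop :=
  [/\ periodic gamma L,
      forall s, derivable gamma s 1,
      exists K : R, forall s t,
        enorm (derive1 gamma s - derive1 gamma t) <= K * `|s - t|,
      forall s, enorm (derive1 gamma s) = 1
    & {in `[0, L[ &, injective gamma}].

Definition gap (R : realType) (s : nat -> R) (k : nat) : R := `|s k.+1 - s k|.

(* For 0 < n the default value gap s 0 is itself one of the n gaps, so these are
   the maximum and the minimum over k = 0, .., n - 1. *)
Definition mesh (R : realType) (s : nat -> R) (n : nat) : R :=
  \big[Num.max/gap s 0%N]_(k < n) gap s k.

Definition min_gap (R : realType) (s : nat -> R) (n : nat) : R :=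
  \big[Num.min/gap s 0%N]_(k < n) gap s k.

(* s n i stands for s_{n,i}; only n0 <= n and i <= n are meaningful. *)
Definition distributed (R : realType) (L c1 c2 : R) (n0 : nat)
    (s : nat -> nat -> R) : Prop :=
  forall n, (n0 <= n)%N ->
    [/\ s n 0%N = 0, s n n = L, forall i, (i < n)%N -> s n i < s n i.+1
      & [/\ c1 / n%:R <= min_gap (s n) n, min_gap (s n) n <= mesh (s n) n,
            mesh (s n) n <= c2 / n%:R & mesh (s n) n <= L / 2]].

(** * Point-tangent data and the tangent-point kernel *)

Record point_tangent (R : realType) := PointTangent {
  pos : 'rV[R]_3;
  tang : 'rV[R]_3 }.

Definition curve_pt (R : realType) (gamma : R -> 'rV[R]_3) (s : R)
    : point_tangent R :=
  PointTangent (gamma s) (derive1 gamma s).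

Definition is_pt_pair (R : realType) (x y : point_tangent R) : Prop :=
  [/\ pos x <> pos y, enorm (tang x) = 1 & enorm (tang y) = 1].

Definition proper_pair (R : realType) (x y : point_tangent R) : Prop :=
  0 < edot (pos y - pos x) (tang x) /\ 0 < edot (pos y - pos x) (tang y).

(* dist (pos x + R tang x, p) *)
Definition line_dist (R : realType) (x : point_tangent R) (p : 'rV[R]_3) : R :=
  inf [set enorm (pos x + r *: tang x - p) | r in [set: R]].

(* Since 0^-1 = 0, the kernel vanishes when pos x = p. *)
Definition tp_kernel (R : realType) (x : point_tangent R) (p : 'rV[R]_3) : R :=
  2 * line_dist x p / enorm (pos x - p) ^+ 2.

Definition TP (R : realType) (q L : R) (gamma : R -> 'rV[R]_3) : \bar R :=
  (\int[(@lebesgue_measure R \x @lebesgue_measure R)%E]_(z in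
      `[0%R, L[ `*` `[0%R, L[)
    (tp_kernel (curve_pt gamma z.1) (gamma z.2) `^ q)%:E)%E.

(** * Circular arcs and biarcs *)

(* The arc starting at arc_start with unit tangent arc_dir0 and constant
   curvature vector arc_curv (the second derivative at the starting point),
   parametrized by arclength on [0, arc_len].  A zero curvature vector gives a
   straight segment. *)
Record circ_arc (R : realType) := CircArc {
  arc_start : 'rV[R]_3;
  arc_dir0 : 'rV[R]_3;
  arc_curv : 'rV[R]_3;
  arc_len : R }.

(* The last condition says that the arc is less than a full turn. *)
Definition is_arc (R : realType) (a : circ_arc R) : Prop :=
  [/\ enorm (arc_dir0 a) = 1, edot (arc_dir0 a) (arc_curv a) = 0,
      0 < arc_len a & enorm (arc_curv a) * arc_len a < 2 * pi].

Definition arc_point (R : realType) (a : circ_arc R) (u : R) : 'rV[R]_3 :=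
  let k := enorm (arc_curv a) in
  if k == 0 then arc_start a + u *: arc_dir0 a
  else arc_start a + (sin (k * u) / k) *: arc_dir0 a
                   + ((1 - cos (k * u)) / k ^+ 2) *: arc_curv a.

(* The derivative of arc_point a at u. *)
Definition arc_dir (R : realType) (a : circ_arc R) (u : R) : 'rV[R]_3 :=
  let k := enorm (arc_curv a) in
  if k == 0 then arc_dir0 a
  else cos (k * u) *: arc_dir0 a + (sin (k * u) / k) *: arc_curv a.

Definition arc_first (R : realType) (a : circ_arc R) : point_tangent R :=
  PointTangent (arc_start a) (arc_dir0 a).

Definition arc_last (R : realType) (a : circ_arc R) : point_tangent R :=
  PointTangent (arc_point a (arc_len a)) (arc_dir a (arc_len a)).

Record biarc (R : realType) := Biarc {
  biarc_fst : circ_arc R;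
  biarc_snd : circ_arc R }.

Definition matching_point (R : realType) (b : biarc R) : 'rV[R]_3 :=
  arc_start (biarc_snd b).

Definition biarc_len (R : realType) (b : biarc R) : R :=
  arc_len (biarc_fst b) + arc_len (biarc_snd b).

Definition interpolates (R : realType) (b : biarc R) (x y : point_tangent R)
    : Prop :=
  is_pt_pair x y /\
  [/\ is_arc (biarc_fst b), is_arc (biarc_snd b),
      arc_first (biarc_fst b) = x,
      arc_last (biarc_fst b) = arc_first (biarc_snd b)
    & arc_last (biarc_snd b) = y].

(* t1^* = 2 <e, t1> e - t1 *)
Definition reflected_tangent (R : realType) (x y : point_tangent R)
    : 'rV[R]_3 :=
  let e := (enorm (pos y - pos x))^-1 *: (pos y - pos x) in
  (2 * edot e (tang y)) *: e - tang y.

Definition incompatible_cocircular (R : realType) (x y : point_tangent R)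
    : Prop :=
  tang x + reflected_tangent x y = 0.

(* Sigma_{++}: there is exactly one arc that starts at pos x with direction
   t0 + t1^* and ends at pos y, unless t0 + t1^* is a nonpositive multiple of
   pos y - pos x; it is the part of C_+ from pos x to pos y in the orientation
   induced by t0 + t1^*, and its interior points form Sigma_{++}.  If t0 + t1^*
   is a negative multiple of pos y - pos x, the oriented line C_+ does not lead
   from pos x to pos y and the set is empty. *)
Definition Sigma_pp (R : realType) (x y : point_tangent R) : set 'rV[R]_3 :=
  let v := tang x + reflected_tangent x y in
  [set m | ~ incompatible_cocircular x y /\
    exists a : circ_arc R,
      [/\ is_arc a, arc_first a = PointTangent (pos x) ((enorm v)^-1 *: v),
          arc_point a (arc_len a) = pos y
        & exists u, 0 < u < arc_len a /\ m = arc_point a u]].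

Definition proper_biarc (R : realType) (b : biarc R) : Prop :=
  exists x y, [/\ interpolates b x y, proper_pair x y
                & Sigma_pp x y (matching_point b)].

Definition gamma_interpolating_balanced (R : realType)
    (gamma : R -> 'rV[R]_3) (b : biarc R) : Prop :=
  exists s h, [/\ 0 < h,
    interpolates b (curve_pt gamma s) (curve_pt gamma (s + h)),
    Sigma_pp (curve_pt gamma s) (curve_pt gamma (s + h)) (matching_point b)
  & enorm (matching_point b - gamma s)
      = enorm (gamma (s + h) - matching_point b)].

(** * Closed biarc curves and the discrete energy *)

(* A curve of n biarcs uses node i for i <= n and arcs i for i < n; the other
   values are irrelevant. *)
Record biarc_curve (R : realType) := BiarcCurve {
  node : nat -> point_tangent R;
  arcs : nat -> biarc R }.

(* The set \tilde B_n; consecutive biarcs share point and tangent at their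
   common node, so the assembled closed curve is C^1. *)
Definition closed_biarc_curve (R : realType) (n : nat) (beta : biarc_curve R)
    : Prop :=
  (forall i, (i < n)%N -> interpolates (arcs beta i) (node beta i)
                                       (node beta i.+1))
  /\ node beta n = node beta 0%N.

Definition proper_biarc_curve (R : realType) (n : nat) (beta : biarc_curve R)
    : Prop :=
  forall i, (i < n)%N -> proper_biarc (arcs beta i).

Definition gamma_interpolating_balanced_curve (R : realType)
    (gamma : R -> 'rV[R]_3) (n : nat) (beta : biarc_curve R) : Prop :=
  forall i, (i < n)%N -> gamma_interpolating_balanced gamma (arcs beta i).

Definition discrete_energy (R : realType) (q : R) (n : nat)
    (beta : biarc_curve R) : R :=
  \sum_(i < n) \sum_(j < n | j != i)
    tp_kernel (node beta j) (pos (node beta i)) `^ q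
      * biarc_len (arcs beta i) * biarc_len (arcs beta j).

(* Main.v *)
Require Import Defs.
From mathcomp Require Import all_boot all_order all_algebra.
From mathcomp Require Import all_classical all_reals all_analysis.
From mathcomp Require Import measurable_realfun ring lra zify.

Set Implicit Arguments.
Unset Strict Implicit.
Unset Printing Implicit Defensive.

Import Order.TTheory GRing.Theory Num.Theory.
Import numFieldNormedType.Exports.

Local Open Scope classical_set_scope.
Local Open Scope ring_scope.

(** For an arclength parametrized closed C^{1,1} curve without self-intersections
    the distance of gamma t from the tangent line at gamma s is quadratic in
    |gamma t - gamma s|, so the tangent-point kernel is bounded, and it is
    Lipschitz with a constant of order 1 / |gamma t - gamma s|.  On the product
    of the partition cells i and j the integrand thus oscillates by at most a
    multiple of the inverse cyclic distance of i and j.  Summing over all cells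
    gives a harmonic sum, hence a quadrature error of order (ln n) / n.  Balanced
    biarcs over an interval of length h have length h + O(h^2), because the
    matching point is O(h^2)-close to the midpoint of the chord; replacing h by
    the biarc lengths costs only O(1 / n). *)

(** Two obstacles shape the argument. The second derivative of a C^{1,1} curve exists only almost
    everywhere, so the kernel need not extend continuously to the diagonal. The diagonal cells
    therefore enter through a uniform bound alone, which suffices because n cells of area O(1/n^2)
    contribute O(1/n). Off the diagonal, with chord w, the numerator of the kernel is divided by
    |w|^2, so it must be Lipschitz with constant O(|w|). A constant O(1) would leave a summed error
    of order one. Arc lengths are never computed from angles. An arc of length l with chord c and
    unit tangent t at either end satisfies l <c, t> <= |c|^2, so a lower bound for <c, t> bounds l
    and excludes long arcs at the same time. The threshold N only makes the gaps small compared with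
    the curvature scale, and ln n <= n^eps / eps for all n >= 1, so N is fixed before eps. *)

(** * Euclidean geometry of R^3 and the distance to a line *)

Section Euclid.
Variable R : realType.
Implicit Types (u v w : 'rV[R]_3) (a b : R).

Lemma edotE u v : edot u v =
  u ord0 ord0 * v ord0 ord0 + u ord0 (lift ord0 ord0) * v ord0 (lift ord0 ord0)
  + u ord0 (lift ord0 (lift ord0 ord0)) * v ord0 (lift ord0 (lift ord0 ord0)).
Proof. by rewrite /edot !big_ord_recl big_ord0 addr0 addrA. Qed.

Lemma edotC u v : edot u v = edot v u.
Proof. by rewrite !edotE; ring. Qed.

Lemma edotDl u v w : edot (u + v) w = edot u w + edot v w.
Proof. by rewrite !edotE !mxE; ring. Qed.

Lemma edotDr u v w : edot w (u + v) = edot w u + edot w v.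
Proof. by rewrite !edotE !mxE; ring. Qed.

Lemma edotZl a u v : edot (a *: u) v = a * edot u v.
Proof. by rewrite !edotE !mxE; ring. Qed.

Lemma edotZr a u v : edot u (a *: v) = a * edot u v.
Proof. by rewrite !edotE !mxE; ring. Qed.

Lemma edotNl u v : edot (- u) v = - edot u v.
Proof. by rewrite !edotE !mxE; ring. Qed.

Lemma edotNr u v : edot u (- v) = - edot u v.
Proof. by rewrite !edotE !mxE; ring. Qed.

Lemma edot0l v : edot 0 v = 0.
Proof. by rewrite !edotE !mxE; ring. Qed.

Definition edot_lin :=
  (edotDl, edotDr, edotZl, edotZr, edotNl, edotNr).

Lemma edot_ge0 u : 0 <= edot u u.
Proof. by rewrite edotE !addr_ge0 // -expr2 sqr_ge0. Qed.

Lemma edot_eq0 u : edot u u = 0 -> u = 0.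
Proof.
rewrite edotE -!expr2 => h.
have [h0 h1 h2] : [/\ u ord0 ord0 = 0, u ord0 (lift ord0 ord0) = 0
    & u ord0 (lift ord0 (lift ord0 ord0)) = 0].
  by split; apply/eqP; rewrite -sqrf_eq0; apply/eqP; nra.
apply/rowP => i; rewrite mxE.
case: i => [[|[|[|//]]] lt_i3]; [rewrite -[RHS]h0|rewrite -[RHS]h1|rewrite -[RHS]h2];
  congr (u _ _); exact: val_inj.
Qed.

(** Lagrange's identity: the difference of the two sides is the squared length of the cross
    product. *)
Lemma cauchy_schwarz_sqr u v : edot u v ^+ 2 <= edot u u * edot v v.
Proof.
rewrite !edotE -subr_ge0.
set a := u _ _; set b := u _ _; set c := u _ _.
set x := v _ _; set y := v _ _; set z := v _ _.
rewrite [leRHS](_ : _ = (a * y - b * x) ^+ 2 + (a * z - c * x) ^+ 2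
  + (b * z - c * y) ^+ 2); last by ring.
by rewrite !addr_ge0 // sqr_ge0.
Qed.

Lemma enorm_ge0 u : 0 <= enorm u.
Proof. exact: sqrtr_ge0. Qed.

Lemma enorm_sqr u : enorm u ^+ 2 = edot u u.
Proof. by rewrite sqr_sqrtr // edot_ge0. Qed.

Lemma enorm0 : enorm (0 : 'rV[R]_3) = 0.
Proof. by rewrite /enorm edot0l sqrtr0. Qed.

Lemma enorm_eq0 u : enorm u = 0 -> u = 0.
Proof. by move=> h; apply: edot_eq0; rewrite -enorm_sqr h expr0n. Qed.

Lemma enorm_gt0 u : u != 0 -> 0 < enorm u.
Proof.
move=> u0; rewrite lt_neqAle enorm_ge0 andbT eq_sym.
by apply: contra u0 => /eqP/enorm_eq0/eqP.
Qed.

Lemma enorm_le u a : 0 <= a -> edot u u <= a ^+ 2 -> enorm u <= a.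
Proof. by move=> a0 h; rewrite -[a]ger0_norm // -sqrtr_sqr ler_wsqrtr. Qed.

Lemma enormN u : enorm (- u) = enorm u.
Proof. by rewrite /enorm edotNl edotNr opprK. Qed.

Lemma enormB u v : enorm (u - v) = enorm (v - u).
Proof. by rewrite -enormN opprB. Qed.

Lemma enormZ a u : enorm (a *: u) = `|a| * enorm u.
Proof.
by rewrite /enorm edotZl edotZr mulrA -expr2 sqrtrM ?sqr_ge0 // sqrtr_sqr.
Qed.

Lemma cauchy_schwarz u v : `|edot u v| <= enorm u * enorm v.
Proof.
rewrite -[leRHS]ger0_norm ?mulr_ge0 ?enorm_ge0 // -ler_sqr ?nnegrE //.
by rewrite !real_normK ?num_real // exprMn !enorm_sqr cauchy_schwarz_sqr.
Qed.

Lemma edot_le u v : edot u v <= enorm u * enorm v.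
Proof. exact: le_trans (ler_norm _) (cauchy_schwarz u v). Qed.

Lemma enormD u v : enorm (u + v) <= enorm u + enorm v.
Proof.
apply: enorm_le; first by rewrite addr_ge0 ?enorm_ge0.
rewrite !edotDl !edotDr (edotC v u) sqrrD !enorm_sqr.
by have := edot_le u v; lra.
Qed.

Lemma enorm_rev u v : `|enorm u - enorm v| <= enorm (u - v).
Proof.
have := enormD (u - v) v; have := enormD (v - u) u.
by rewrite !subrK (enormB v u) ler_norml => h1 h2; apply/andP; split; lra.
Qed.

Definition perp_part (t w : 'rV[R]_3) : 'rV[R]_3 := w - edot w t *: t.

Lemma perp_partD t u v : perp_part t (u + v) = perp_part t u + perp_part t v.
Proof. by rewrite /perp_part edotDl scalerDl opprD addrACA. Qed.

Lemma perp_partZ t a u : perp_part t (a *: u) = a *: perp_part t u.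
Proof. by rewrite /perp_part edotZl scalerBr scalerA. Qed.

Lemma perp_partN t u : perp_part t (- u) = - perp_part t u.
Proof. by rewrite /perp_part edotNl scaleNr opprB addrC opprK. Qed.

Lemma perp_partB t u v : perp_part t (u - v) = perp_part t u - perp_part t v.
Proof. by rewrite perp_partD perp_partN. Qed.

Lemma perp_part_self t : enorm t = 1 -> perp_part t t = 0.
Proof. by move=> t1; rewrite /perp_part -enorm_sqr t1 expr1n scale1r subrr. Qed.

Lemma perp_part_subr t u : enorm t = 1 -> perp_part t (u - t) = perp_part t u.
Proof. by move=> t1; rewrite perp_partB perp_part_self // subr0. Qed.

(** Both terms carry the factor [t' - t], so turning the tangent costs at most a multiple of
    [enorm w * enorm (t' - t)]. *)
Lemma perp_part_diff t t' w : perp_part t w - perp_part t' w =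
  edot w t' *: (t' - t) + edot w (t' - t) *: t.
Proof.
by rewrite edotDr edotNr /perp_part; apply/rowP => i; rewrite !mxE; ring.
Qed.

Lemma perp_part_min t w a : enorm t = 1 ->
  enorm (perp_part t w) <= enorm (w - a *: t).
Proof.
move=> t1; apply: enorm_le; first exact: enorm_ge0.
have tt : edot t t = 1 by rewrite -enorm_sqr t1 expr1n.
rewrite enorm_sqr /perp_part !edot_lin tt (edotC t w).
by have := sqr_ge0 (edot w t - a); nra.
Qed.

Lemma perp_part_le t w : enorm t = 1 -> enorm (perp_part t w) <= enorm w.
Proof. by move=> t1; have := perp_part_min w 0 t1; rewrite scale0r subr0. Qed.

(** The infimum is attained at the foot of the perpendicular. From here on the distance is the norm
    of a vector linear in [p], which is what makes differences of kernels tractable. *)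
Lemma line_distE (x : point_tangent R) p : enorm (tang x) = 1 ->
  line_dist x p = enorm (perp_part (tang x) (p - pos x)).
Proof.
move=> t1; rewrite /line_dist; set S := [set _ | _ in _].
have lbS : lbound S (enorm (perp_part (tang x) (p - pos x))).
  move=> _ [r _ <-]; apply: (le_trans (perp_part_min _ r t1)).
  by rewrite -addrA -opprD enormB.
have memS : S (enorm (perp_part (tang x) (p - pos x))).
  exists (edot (p - pos x) (tang x)) => //.
  by rewrite /perp_part -[in RHS]addrA -opprD [RHS]enormB.
apply/eqP; rewrite eq_le; apply/andP; split.
  by apply: ge_inf => //; exists (enorm (perp_part (tang x) (p - pos x))).
exact: lb_le_inf (ex_intro _ _ memS) lbS.
Qed.

Lemma tp_kernelE (x : point_tangent R) p : enorm (tang x) = 1 ->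
  tp_kernel x p =
  2 * enorm (perp_part (tang x) (p - pos x)) / enorm (p - pos x) ^+ 2.
Proof. by move=> t1; rewrite /tp_kernel line_distE // (enormB (pos x)). Qed.

End Euclid.

(** * Circular arcs: length against chord and end tangents *)

Section Arcs.
Variable R : realType.
Implicit Types (x y u v : R) (a : circ_arc R).

Lemma norm_sin_le x : 0 <= x -> `|sin x| <= x.
Proof.
move=> x0.
have [|c _] := @MVT_segment R sin cos 0 x x0 (fun y _ => is_derive_sin y).
  exact/continuous_subspaceT/continuous_sin.
rewrite sin0 !subr0 => ->; rewrite normrM (ger0_norm x0) -[leRHS]mul1r.
by rewrite ler_wpM2r // cos_max.
Qed.

(** sin y - y cos y vanishes at 0 and has derivative y sin y >= 0 on [0, pi]. The range reaches pi,
    so arcs up to a full turn are covered when x is the half angle. *)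
Lemma mul_cos_le_sin x : 0 <= x <= pi -> x * cos x <= sin x.
Proof.
move=> /andP[x0 xpi].
pose f (y : R) := sin y - y * cos y.
have df y : is_derive y 1 f (y * sin y).
  apply: is_derive_eq; rewrite -![_ *: _]/(_ * _); ring.
have [|c] := @MVT_segment R f (fun y => y * sin y) 0 x x0 (fun y _ => df y).
  apply/continuous_subspaceT => y; apply: differentiable_continuous.
  by have ? := df y; exact/derivable1_diffP/ex_derive.
rewrite /f sin0 mul0r !subr0 in_itv /= => /andP[c0 cx] e.
rewrite -subr_ge0 e !mulr_ge0 // sin_ge0_pi // c0 /=.
exact: le_trans cx xpi.
Qed.

Lemma onemcosE x : 1 - cos x = 2 * sin (x / 2) ^+ 2.
Proof.
have := cos_mulr2n (x / 2); rewrite -(mulr_natr (x / 2)) divfK ?pnatr_eq0 // => ->.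
by rewrite cos2sin2; ring.
Qed.

Lemma sin_double x : sin x = 2 * sin (x / 2) * cos (x / 2).
Proof.
have := sin_mulr2n (x / 2); rewrite -(mulr_natr (x / 2)) divfK ?pnatr_eq0 // => ->.
by ring.
Qed.

Lemma onemcos_le x : 2 * (1 - cos x) <= x ^+ 2.
Proof.
rewrite -[cos x]cos_norm -[x ^+ 2]real_normK ?num_real //.
have := normr_ge0 x; move: `|x| => {}x x0; rewrite onemcosE.
have h0 : 0 <= x / 2 by lra.
have := norm_sin_le h0; rewrite ler_norml => /andP[h1 h2].
by nra.
Qed.

Section ArcPoint.
Variables (a : circ_arc R).
Hypothesis dir1 : enorm (arc_dir0 a) = 1.
Hypothesis dir_curv : edot (arc_dir0 a) (arc_curv a) = 0.
Let k := enorm (arc_curv a).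

Let add_addK (p d c : 'rV[R]_3) : p + d + c - p = d + c.
Proof. by rewrite -(addrA p) addrAC subrr add0r. Qed.

Let dd : edot (arc_dir0 a) (arc_dir0 a) = 1.
Proof. by rewrite -enorm_sqr dir1 expr1n. Qed.

Let cc : edot (arc_curv a) (arc_curv a) = k ^+ 2.
Proof. by rewrite -enorm_sqr. Qed.

Lemma arc_chord_edot0 u :
  edot (arc_point a u - arc_start a) (arc_dir0 a) =
  if k == 0 then u else sin (k * u) / k.
Proof.
rewrite /arc_point -/k; case: ifP => [_|/negbT k0].
  by rewrite addrAC subrr add0r edotZl dd mulr1.
rewrite add_addK !edot_lin dd (edotC (arc_curv a)) dir_curv.
by ring.
Qed.

(** The value agrees with the one at the start: a chord of a circle meets the tangents at its two
    ends under equal angles. Bounds at the end thus reduce to bounds at the start. *)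
Lemma arc_chord_edot u :
  edot (arc_point a u - arc_start a) (arc_dir a u) =
  if k == 0 then u else sin (k * u) / k.
Proof.
rewrite /arc_point /arc_dir -/k; case: ifP => [_|/negbT k0].
  by rewrite addrAC subrr add0r edotZl dd mulr1.
rewrite add_addK !edot_lin dd (edotC (arc_curv a)) dir_curv cc.
by field.
Qed.

Lemma arc_chord_sqr u v :
  edot (arc_point a v - arc_point a u) (arc_point a v - arc_point a u) =
  if k == 0 then (v - u) ^+ 2 else 2 * (1 - cos (k * (v - u))) / k ^+ 2.
Proof.
rewrite /arc_point -/k; case: ifP => [_|/negbT k0].
  rewrite (_ : _ - _ = (v - u) *: arc_dir0 a); last first.
    by apply/rowP => i; rewrite !mxE; ring.
  by rewrite !edot_lin dd; ring.
have -> : forall (p d c : 'rV[R]_3) x1 y1 x2 y2,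
  p + x1 *: d + y1 *: c - (p + x2 *: d + y2 *: c) =
  (x1 - x2) *: d + (y1 - y2) *: c.
  by move=> p d c x1 y1 x2 y2; apply/rowP => i; rewrite !mxE; ring.
rewrite !edot_lin dd (edotC (arc_curv a)) dir_curv cc (mulrBr k) cosB.
have := cos2sin2 (k * u); have := cos2sin2 (k * v).
move: (cos (k * u)) (cos (k * v)) (sin (k * u)) (sin (k * v)).
move=> cu cv su sv hv hu.
apply: (mulIf (expf_neq0 2 k0)); rewrite divfK ?expf_neq0 //.
transitivity ((sv - su) ^+ 2 + (cu - cv) ^+ 2); first by field.
by rewrite [LHS](_ : _ = sv ^+ 2 + su ^+ 2 + cu ^+ 2 + cv ^+ 2
  - 2 * (cv * cu + sv * su)); [rewrite hu hv|]; ring.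
Qed.

Lemma arc_chord_le u v : u <= v ->
  enorm (arc_point a v - arc_point a u) <= v - u.
Proof.
move=> uv; apply: enorm_le; first by rewrite subr_ge0.
rewrite arc_chord_sqr; case: ifP => // /negbT k0.
have k2 : 0 < k ^+ 2 by rewrite lt_neqAle sqr_ge0 eq_sym expf_neq0.
by rewrite ler_pdivrMr // (le_trans (onemcos_le _)) // exprMn mulrC.
Qed.

Lemma arc_point0 : arc_point a 0 = arc_start a.
Proof.
rewrite /arc_point -/k; case: ifP => _; rewrite ?scale0r ?addr0 //.
by rewrite mulr0 sin0 cos0 subrr !mul0r !scale0r !addr0.
Qed.

End ArcPoint.

(** With curvature k and half angle x = k l / 2, the chord has length 2 sin x / k and tangential
    component sin(2x) / k. The claim is x cos x <= sin x multiplied by 4 sin x / k^2, and less than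
    a full turn means x < pi. *)
Lemma arc_len_edot0_le a : is_arc a ->
  arc_len a * edot (arc_point a (arc_len a) - arc_start a) (arc_dir0 a)
  <= enorm (arc_point a (arc_len a) - arc_start a) ^+ 2.
Proof.
move=> [d1 dc l0 kl]; rewrite enorm_sqr arc_chord_edot0 //.
have := arc_chord_sqr d1 dc 0 (arc_len a); rewrite arc_point0 subr0 => ->.
have := enorm_ge0 (arc_curv a); move: kl.
set k := enorm _; set l := arc_len a in l0 *.
move=> kl k0; case: ifPn => kn0; first by rewrite expr2.
have {}k0 : 0 < k by rewrite lt_neqAle eq_sym kn0.
rewrite onemcosE sin_double.
have x0 : 0 <= k * l / 2 by rewrite divr_ge0 // mulr_ge0 // ltW.
have xpi : k * l / 2 <= pi by move: (kl : k * l < _); lra.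
have hx : 0 <= k * l / 2 <= pi by rewrite x0.
have h1 := mul_cos_le_sin hx; have h2 := sin_ge0_pi hx.
rewrite ler_pdivlMr ?exprn_gt0 //.
move: h1 h2; set s := sin _; set c := cos _ => h1 h2.
rewrite [leLHS](_ : _ = 4 * s * (k * l / 2 * c)); last by field.
rewrite [leRHS](_ : _ = 4 * s * s); last by ring.
by rewrite ler_wpM2l // mulr_ge0.
Qed.

Lemma arc_len_edot_le a : is_arc a ->
  arc_len a * edot (arc_point a (arc_len a) - arc_start a)
                   (arc_dir a (arc_len a))
  <= enorm (arc_point a (arc_len a) - arc_start a) ^+ 2.
Proof.
move=> ha; have [d1 dc _ _] := ha.
by rewrite arc_chord_edot // -arc_chord_edot0 // arc_len_edot0_le.
Qed.

End Arcs.

(** * Length of a balanced biarc *)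

Section BiarcLength.
Variable R : realType.
Implicit Types (x y : point_tangent R) (a : circ_arc R).

Lemma arc_len_bounds a (p q : 'rV[R]_3) : is_arc a ->
  arc_start a = p -> arc_point a (arc_len a) = q ->
  [/\ enorm (q - p) <= arc_len a,
      arc_len a * edot (q - p) (arc_dir0 a) <= enorm (q - p) ^+ 2
    & arc_len a * edot (q - p) (arc_dir a (arc_len a)) <= enorm (q - p) ^+ 2].
Proof.
move=> ha <- <-; split; last 2 first.
- exact: arc_len_edot0_le.
- exact: arc_len_edot_le.
have [d1 dc l0 _] := ha.
by have := arc_chord_le d1 dc (ltW l0); rewrite arc_point0 subr0.
Qed.

(* The oriented circle through both points leaves pos x in the direction
   tang x + t1^*, whose component along the chord is at least the mean of
   those of tang x and tang y. *)
Lemma Sigma_pp_dist x y m (c : R) : is_pt_pair x y -> 0 < c ->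
  c * enorm (pos y - pos x) <= edot (pos y - pos x) (tang x) ->
  c * enorm (pos y - pos x) <= edot (pos y - pos x) (tang y) ->
  Sigma_pp x y m ->
  c * (enorm (m - pos x) + enorm (pos y - m)) <= enorm (pos y - pos x).
Proof.
move=> [xy tx ty] c0 hx hy [v0 [a [ha afst alast [u [/andP[u0 ul] ->]]]]].
move: v0 afst; rewrite /incompatible_cocircular.
move: hx hy; move Ew : (pos y - pos x) => w hx hy; set v := (_ + _) => v0 [as_ ad].
have w0 : 0 < enorm w by rewrite -Ew enorm_gt0 // subr_eq0; apply/eqP => /esym.
have vgt0 : 0 < enorm v by apply: enorm_gt0; apply/eqP.
have [d1 dc l0 _] := ha.
have := arc_chord_le d1 dc (ltW u0); rewrite arc_point0 // subr0 as_ => h1.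
have := arc_chord_le d1 dc (ltW ul); rewrite alast => h2.
have [_ h3 _] := arc_len_bounds ha as_ alast.
(* Reflection in the chord direction keeps the component along the chord. It is also an isometry, so
   [v] has norm at most 2, and normalising it loses nothing against the mean. *)
have wv : edot w v = edot w (tang x) + edot w (tang y).
  rewrite /v /reflected_tangent Ew !edot_lin -enorm_sqr.
  by field; rewrite gt_eqF.
have v2 : enorm v <= 2.
  apply: le_trans (enormD _ _) _; rewrite tx.
  suff -> : enorm (reflected_tangent x y) = 1 by lra.
  rewrite /enorm /reflected_tangent Ew !edot_lin.
  rewrite -(enorm_sqr (tang y)) ty -enorm_sqr (edotC (tang y)) -[RHS]sqrtr1; congr Num.sqrt.
  by field; rewrite gt_eqF.
move: h3; rewrite ad edotZr Ew wv => h3.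
have h4 : c * enorm w <= (enorm v)^-1 * (edot w (tang x) + edot w (tang y)).
  rewrite [leRHS]mulrC ler_pdivlMr //.
  have : 0 <= c * enorm w by rewrite mulr_ge0 // ltW.
  by nra.
have h5 : arc_len a * (c * enorm w) <= enorm w ^+ 2.
  by apply: le_trans h3; rewrite ler_wpM2l // ltW.
have h6 : c * arc_len a <= enorm w.
  by rewrite -(ler_pM2r w0); rewrite -expr2; lra.
apply: le_trans h6; rewrite ler_wpM2l ?(ltW c0) //; lra.
Qed.

(** The half chords differ from half the chord by at most [eta] times its length, so they keep
    nearly full components along the given tangents at their outer ends. The arc inequality applied
    at these ends bounds each arc; the direction at the matching point is never estimated. The
    factor 10 is generous. *)
Lemma biarc_len_bounds (b : biarc R) x y (eta : R) :
  0 <= eta -> eta <= 10^-1 -> interpolates b x y ->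
  Sigma_pp x y (matching_point b) ->
  enorm (matching_point b - pos x) = enorm (pos y - matching_point b) ->
  (1 - eta ^+ 2) * enorm (pos y - pos x) <= edot (pos y - pos x) (tang x) ->
  (1 - eta ^+ 2) * enorm (pos y - pos x) <= edot (pos y - pos x) (tang y) ->
  enorm (pos y - pos x) <= biarc_len b
    <= (1 + 10 * eta) * enorm (pos y - pos x).
Proof.
move=> eta0 eta1 [xy [ha hb afst alast blast]] hS hbal hx hy.
have eta2 : eta ^+ 2 <= eta / 10 by nra.
have c0 : 0 < 1 - eta ^+ 2 by nra.
have := Sigma_pp_dist xy c0 hx hy hS.
have [xy' tx ty] := xy.
have w0 : 0 < enorm (pos y - pos x).
  by rewrite enorm_gt0 // subr_eq0; apply/eqP => /esym.
move: hbal hx hy w0; rewrite /biarc_len.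
case: alast => alast_p alast_d; rewrite /matching_point -alast_p.
have ax : arc_start (biarc_fst b) = pos x by rewrite -afst.
have bx : arc_start (biarc_snd b) = arc_point _ _ := esym alast_p.
have by_ : arc_point (biarc_snd b) (arc_len (biarc_snd b)) = pos y.
  by rewrite -blast.
have [k1 k2 _] := arc_len_bounds ha ax erefl.
have [k3 _ k4] := arc_len_bounds hb bx by_.
move: k1 k2 k3 k4; rewrite (_ : arc_dir0 (biarc_fst b) = tang x) -?afst //.
rewrite (_ : arc_dir (biarc_snd b) _ = tang y) -?blast // afst blast.
move: (arc_point _ _) => m.
rewrite (_ : pos y - m = pos y - pos x - (m - pos x)); last first.
  by rewrite opprB addrA subrK.
move: (pos y - pos x) (m - pos x) => w e.
set A := arc_len _; set B := arc_len (biarc_snd b).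
move=> k1 k2 k3 k4 hbal hx hy w0; rewrite -hbal => h1.
have l0 : 0 < A by case: ha.
have l1 : 0 < B by case: hb.
set r := enorm e in hbal h1 k1 k2; rewrite -/r in hbal; rewrite -hbal in k3 k4.
have r2 : r ^+ 2 = edot e e by rewrite enorm_sqr.
have r0 : 0 <= r by exact: enorm_ge0.
have w2 : enorm w ^+ 2 = edot w w by rewrite enorm_sqr.
have hb' : r ^+ 2 = edot (w - e) (w - e) by rewrite hbal enorm_sqr.
have [f Ef] : exists f, f = e - 2^-1 *: w by eexists.
(* Balance makes the triangle isosceles, so [f], the offset of the matching point from the midpoint
   of the chord, is its height and Pythagoras gives the length. *)
have f2 : enorm f ^+ 2 = r ^+ 2 - enorm w ^+ 2 / 4.
  move: hb'; rewrite enorm_sqr Ef r2 w2 !edot_lin (edotC w e); lra.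
have rw : 2 * r >= enorm w.
  have := enormD e (w - e); rewrite addrC subrK -hbal -/r; lra.
have f0 := enorm_ge0 f.
set d := enorm w in hx hy h1 w2 f2 rw w0 *.
(* Since 2r (1 - eta^2) <= d, the excess 4r^2 - d^2 = 4 |f|^2 is at most 4 d^2 eta^2; here eta <=
   1/10 is used to bound 2r by 1.02 d. *)
have fle : enorm f <= d * eta.
  have h2 : 2 * r * (1 - eta ^+ 2) <= d by lra.
  have h3 : 4 * r ^+ 2 - d ^+ 2 <= 4 * d ^+ 2 * eta ^+ 2.
    have h4 : (2 * r) * (1 - 2 * eta ^+ 2) * (2 * r) <= d ^+ 2 by nra.
    have h5 : 2 * r <= 102%:R / 100%:R * d by nra.
    have h6 : (2 * r) ^+ 2 <= 2 * d ^+ 2.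
      have : (2 * r) ^+ 2 <= (102%:R / 100%:R * d) ^+ 2.
        by rewrite ler_sqr ?nnegrE ?mulr_ge0 // ltW.
      by have := sqr_ge0 d; lra.
    by have := ler_wpM2l (sqr_ge0 eta) h6; lra.
  rewrite -ler_sqr ?nnegrE ?mulr_ge0 // ?(ltW w0) // f2 exprMn; lra.
have e1 : edot e (tang x) >= d / 2 * (1 - eta ^+ 2 - 2 * eta).
  have := cauchy_schwarz f (tang x); rewrite tx mulr1 ler_norml => /andP[+ _].
  by rewrite {2}Ef !edot_lin; lra.
have e2 : edot (w - e) (tang y) >= d / 2 * (1 - eta ^+ 2 - 2 * eta).
  have := cauchy_schwarz f (tang y); rewrite ty mulr1 ler_norml => /andP[_ +].
  by rewrite {1}Ef !edot_lin; lra.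
(* With z = 1 - eta^2, multiplying by 4 z^2 and using 2 r z <= d gives 2 l (z - 2 eta) z^2 <= d. The
   factor (z - 2 eta) z^2 is at least 1 - 2.3 eta, whose inverse is below 1 + 10 eta. *)
have key (l : R) : 0 < l -> l * (d / 2 * (1 - eta ^+ 2 - 2 * eta)) <= r ^+ 2 ->
    l <= d / 2 * (1 + 10 * eta).
  move=> lp hl.
  have h2 : 2 * r * (1 - eta ^+ 2) <= d by lra.
  set z := 1 - eta ^+ 2 in h2 c0 hl *.
  have h4 : (2 * r * z) ^+ 2 <= d ^+ 2.
    by rewrite ler_sqr ?nnegrE ?mulr_ge0 ?(ltW c0) ?(ltW w0).
  have h5 : l * (2 * (z - 2 * eta) * z ^+ 2) * d <= d * d.
    have : 0 <= z ^+ 2 by exact: sqr_ge0.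
    nra.
  rewrite ler_pM2r // in h5.
  have h6 : (z - 2 * eta) * z ^+ 2 >= 1 - 23%:R / 10%:R * eta.
    have z1 : 1 - eta / 10 <= z by rewrite /z; lra.
    have z2 : z ^+ 2 >= 1 - eta / 5 by nra.
    nra.
  have h7 : l * (2 * (1 - 23%:R / 10%:R * eta)) <= d.
    by apply: le_trans h5; rewrite ler_pM2l //; lra.
  have h8 : (1 - 23%:R / 10%:R * eta) * (1 + 10 * eta) >= 1 by nra.
  have h9 : 0 < 1 + 10 * eta by lra.
  have : l * (2 * (1 - 23%:R / 10%:R * eta)) * (1 + 10 * eta) <= d * (1 + 10 * eta).
    by rewrite ler_pM2r.
  nra.
have kA : A <= d / 2 * (1 + 10 * eta).
  by apply: key => //; apply: le_trans k2; rewrite ler_pM2l.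
have kB : B <= d / 2 * (1 + 10 * eta).
  by apply: key => //; apply: le_trans k4; rewrite ler_pM2l.
by apply/andP; split; lra.
Qed.

End BiarcLength.

(** * Local estimates for arclength curves with Lipschitz tangent *)

Section Curve.
Variables (R : realType) (gamma : R -> 'rV[R]_3) (K : R).
Hypothesis derivable_gamma : forall s, derivable gamma s 1.
Hypothesis K_gt0 : 0 < K.
Hypothesis tangent_lip : forall s t,
  enorm (derive1 gamma s - derive1 gamma t) <= K * `|s - t|.
Hypothesis tangent_unit : forall s, enorm (derive1 gamma s) = 1.
Implicit Types (a b s t : R) (v : 'rV[R]_3).

Lemma is_derive_coord (f : R -> 'rV[R]_3) s df j :
  is_derive s 1 f df -> is_derive s 1 (fun t => f t ord0 j) (df ord0 j).
Proof.
move=> [fdrv fdf].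
have h : (fun h => h^-1 *: ((fun t => f t ord0 j) (h *: 1 + s) - f s ord0 j))
    @ 0^' --> (df ord0 j : R).
  have -> : (fun h => h^-1 *: ((fun t => f t ord0 j) (h *: 1 + s) - f s ord0 j))
     = (fun M : 'rV[R]_3 => M ord0 j) \o (fun h => h^-1 *: (f (h *: 1 + s) - f s)).
    by apply/funext => h /=; rewrite !mxE.
  apply: cvg_comp; last exact: coord_continuous.
  by rewrite -fdf; exact: fdrv.
by apply: DeriveDef; [apply/cvg_ex; exists (df ord0 j)|exact: cvg_lim h].
Qed.

Lemma is_derive_edot (f : R -> 'rV[R]_3) s df v :
  is_derive s 1 f df -> is_derive s 1 (fun t => edot (f t) v) (edot df v).
Proof.
move=> fdf; have d j := is_derive_coord j fdf.
rewrite (_ : (fun t => _) = \sum_(i < 3) (fun t => v ord0 i *: f t ord0 i)); last first.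
  by apply/funext => t; rewrite fct_sumE; apply: eq_bigr => i _; rewrite mulrC.
apply: is_derive_eq.
by apply: eq_bigr => i _; rewrite mulrC.
Qed.

(** Pairing with a fixed vector reduces the mean value theorem to the scalar case. Choosing [v] as
    the very vector to be estimated then yields norm bounds without integration. *)
Lemma curve_mvt a b v : a <= b ->
  exists2 c, a <= c <= b &
    edot (gamma b - gamma a) v = (b - a) * edot (derive1 gamma c) v.
Proof.
move=> ab.
have dg (c : R) : is_derive c 1 (fun t => edot (gamma t) v) (edot (derive1 gamma c) v).
  by apply: is_derive_edot; rewrite derive1E; apply: derivableP.
have [|c cab e] := @MVT_segment R (fun t => edot (gamma t) v)
  (fun c => edot (derive1 gamma c) v) a b ab (fun c _ => dg c).
  apply/continuous_subspaceT => c; apply: differentiable_continuous.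
  by have ? := dg c; exact/derivable1_diffP/ex_derive.
by exists c; [rewrite in_itv /= in cab|rewrite edotDl edotNl e mulrC].
Qed.

Lemma curve_lip_le a b : a <= b -> enorm (gamma b - gamma a) <= b - a.
Proof.
move=> ab; have [c _ h] := curve_mvt (gamma b - gamma a) ab.
have := edot_le (derive1 gamma c) (gamma b - gamma a).
rewrite tangent_unit mul1r => h1; move: h; rewrite -enorm_sqr.
have := enorm_ge0 (gamma b - gamma a); set n := enorm _ in h1 *.
move: (edot _ _) h1 => x h1 n0 h.
have [->|n1] := eqVneq n 0; first by rewrite subr_ge0.
have n2 : 0 < n by rewrite lt_neqAle eq_sym n1.
by rewrite -(ler_pM2r n2) -expr2 h ler_wpM2l // subr_ge0.
Qed.

Lemma curve_lip a b : enorm (gamma b - gamma a) <= `|b - a|.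
Proof.
have [ab|/ltW ba] := leP a b.
  by rewrite ger0_norm ?subr_ge0 // curve_lip_le.
by rewrite enormB distrC ger0_norm ?subr_ge0 // curve_lip_le.
Qed.

(** The remainder w is paired with itself: |w|^2 <= K (b - a)^2 |w|. Using an intermediate point
    instead of an integral costs only the factor 1/2 in the constant. *)
Lemma curve_taylor a b :
  enorm (gamma b - gamma a - (b - a) *: derive1 gamma a) <= K * (b - a) ^+ 2.
Proof.
set w := (X in enorm X); set T := derive1 gamma a.
have [c hc hw] : exists2 c, `|c - a| <= `|b - a| &
    edot w w = (b - a) * edot (derive1 gamma c - T) w.
  have [ab|/ltW ba] := leP a b.
    have [c /andP[ac cb] h] := curve_mvt w ab.
    exists c; first by rewrite !ger0_norm ?subr_ge0 // lerD2r.
    by rewrite {1}/w edotDl edotNl edotZl h edotDl edotNl -mulrBr.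
  have [c /andP[bc ca] h] := curve_mvt w ba.
  exists c; first by rewrite !ler0_norm ?subr_le0 // !opprB lerD2l lerN2.
  by rewrite {1}/w -(opprB (gamma a)) !edotDl !edotNl edotZl h; ring.
have h1 : edot w w <= K * (b - a) ^+ 2 * enorm w.
  rewrite hw (le_trans (ler_norm _)) // normrM.
  have h2 := cauchy_schwarz (derive1 gamma c - T) w.
  have h3 := tangent_lip c a.
  have h4 : K * `|c - a| <= K * `|b - a| by rewrite ler_pM2l.
  have h5 : `|edot (derive1 gamma c - T) w| <= K * `|b - a| * enorm w.
    apply: (le_trans h2); rewrite ler_wpM2r ?enorm_ge0 //; exact: le_trans h3 h4.
  rewrite -[(b - a) ^+ 2]real_normK ?num_real //.
  by rewrite [leRHS](_ : _ = `|b - a| * (K * `|b - a| * enorm w)); [rewrite ler_wpM2l|ring].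
move: h1; rewrite -enorm_sqr; have := enorm_ge0 w.
have [-> _ _|n1 n0] := eqVneq (enorm w) 0; first by rewrite mulr_ge0 ?sqr_ge0 ?(ltW K_gt0).
have n2 : 0 < enorm w by rewrite lt_neqAle eq_sym n1.
by rewrite expr2 ler_pM2r.
Qed.

Lemma edot_unit (u v : 'rV[R]_3) : enorm u = 1 -> enorm v = 1 ->
  edot u v = 1 - enorm (u - v) ^+ 2 / 2.
Proof.
move=> u1 v1; rewrite enorm_sqr !edot_lin -!enorm_sqr u1 v1 (edotC v u).
by rewrite expr1n; field.
Qed.

(** For unit vectors <u, v> = 1 - |u - v|^2 / 2, so the loss is quadratic in K (b - a). A linear
    loss would make the [eta] of the biarc bound of order sqrt h and spoil the length estimate. *)
Lemma curve_chord_edot_ge a b p : a <= p <= b ->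
  (b - a) * (1 - (K * (b - a)) ^+ 2 / 2)
    <= edot (gamma b - gamma a) (derive1 gamma p).
Proof.
move=> /andP[ap pb]; have ab := le_trans ap pb.
have [c /andP[ac cb] ->] := curve_mvt (derive1 gamma p) ab.
rewrite ler_wpM2l ?subr_ge0 // edot_unit // lerD2l lerN2 ler_pM2r ?invr_gt0 //.
rewrite ler_sqr ?nnegrE ?enorm_ge0 ?mulr_ge0 ?subr_ge0 ?(ltW K_gt0) //.
apply: (le_trans (tangent_lip _ _)); rewrite ler_pM2l // ler_norml.
by apply/andP; split; lra.
Qed.

Lemma curve_coord_continuous j : continuous (fun s => gamma s ord0 j).
Proof.
move=> s; apply: differentiable_continuous; apply/derivable1_diffP.
have ? : is_derive s 1 (fun s => gamma s ord0 j) (derive1 gamma s ord0 j).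
  by apply: is_derive_coord; rewrite derive1E; apply: derivableP.
exact: ex_derive.
Qed.

Lemma coord_le_enorm (u : 'rV[R]_3) j : `|u ord0 j| <= enorm u.
Proof.
rewrite -ler_sqr ?nnegrE ?normr_ge0 ?enorm_ge0 // real_normK ?num_real //.
rewrite enorm_sqr /edot (bigD1 j) //= expr2 lerDl sumr_ge0 // => i _.
by rewrite -expr2 sqr_ge0.
Qed.

Lemma tangent_coord_continuous j : continuous (fun s => derive1 gamma s ord0 j).
Proof.
move=> s; apply/cvgrPdist_le => /= e e0.
near=> t.
have := coord_le_enorm (derive1 gamma s - derive1 gamma t) j.
rewrite !mxE => /le_trans; apply; apply: (le_trans (tangent_lip _ _)).
rewrite mulrC -ler_pdivlMr //; near: t.
by apply: cvgr_dist_le => //; exact: divr_gt0.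
Unshelve. all: by end_near. Qed.

End Curve.

(** * Chord-arc inequality on the circle *)

Section ClosedCurve.
Variables (R : realType) (gamma : R -> 'rV[R]_3) (K L : R).
Hypothesis L_gt0 : 0 < L.
Hypothesis gamma_periodic : periodic gamma L.
Hypothesis gamma_inj : {in `[0, L[ &, injective gamma}.
Hypothesis derivable_gamma : forall s, derivable gamma s 1.
Hypothesis K_gt0 : 0 < K.
Hypothesis tangent_lip : forall s t,
  enorm (derive1 gamma s - derive1 gamma t) <= K * `|s - t|.
Hypothesis tangent_unit : forall s, enorm (derive1 gamma s) = 1.
Implicit Types (a b s t : R).

Lemma tangent_periodic : periodic (derive1 gamma) L.
Proof.
move=> s; rewrite /derive1.
have -> // : (fun h => h^-1 *: (gamma (h + (s + L)) - gamma (s + L))) =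
  (fun h => h^-1 *: (gamma (h + s) - gamma s)).
by apply/funext => h; rewrite addrA !gamma_periodic.
Qed.

Lemma curve_neq a h : 0 <= a <= L -> 0 < h < L -> gamma (a + h) != gamma a.
Proof.
move=> /andP[a0 aL] /andP[h0 hL].
(* Injectivity is available on the half-open period only: the base point [L] is moved to 0, and
   below a parameter [a + h] beyond [L] is wrapped once. *)
suff base x : 0 <= x -> x < L -> gamma (x + h) != gamma x.
  move: aL; rewrite le_eqVlt => /orP[/eqP->|aL]; last exact: base.
  rewrite addrC gamma_periodic -(add0r h) -(add0r L) (gamma_periodic 0).
  exact: (base 0).
clear a a0 aL => a0 aL; move: x a0 aL => a a0 aL.
apply/eqP; have [ahL|ahL] := ltP (a + h) L.
  move=> /gamma_inj e; have : a + h = a.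
    by apply: e; rewrite in_itv /=; apply/andP; split; lra.
  by lra.
rewrite -(subrK L (a + h)) gamma_periodic => /gamma_inj e.
have : a + h - L = a by apply: e; rewrite in_itv /=; apply/andP; split; lra.
by lra.
Qed.

Let chord_sqr (z : R * R) :=
  edot (gamma (z.1 + z.2) - gamma z.1) (gamma (z.1 + z.2) - gamma z.1).

Let chord_sqr_continuous : continuous chord_sqr.
Proof.
pose f (j : 'I_3) (z : R * R) := gamma (z.1 + z.2) ord0 j - gamma z.1 ord0 j.
have cf j : continuous (f j).
  move=> z; apply: cvgB.
    apply: (@cvg_comp _ _ _ (fun z : R * R => z.1 + z.2) (fun s => gamma s ord0 j)).
      by apply: cvgD; [exact: cvg_fst|exact: cvg_snd].
    exact: (curve_coord_continuous derivable_gamma).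
  apply: (@cvg_comp _ _ _ (fun z : R * R => z.1) (fun s => gamma s ord0 j)).
    exact: cvg_fst.
  exact: (curve_coord_continuous derivable_gamma).
rewrite (_ : chord_sqr = fun z => f ord0 z * f ord0 z +
  f (lift ord0 ord0) z * f (lift ord0 ord0) z +
  f (lift ord0 (lift ord0 ord0)) z * f (lift ord0 (lift ord0 ord0)) z).
  move=> z; apply: cvgD; first apply: cvgD.
  - by apply: cvgM; exact: cf.
  - by apply: cvgM; exact: cf.
  - by apply: cvgM; exact: cf.
by apply/funext => z; rewrite /chord_sqr edotE !mxE.
Qed.

(** For lags up to 1/K the chord keeps at least half of its tangential component. The remaining lags
    up to L/2, with base points in [0, L], form a compact set on which injectivity forces a positive
    minimum m of the chord; L / m serves there. *)
Lemma chord_arc : exists2 C, 0 < C & forall a h, 0 <= a <= L -> 0 <= h <= L / 2 ->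
  h <= C * enorm (gamma (a + h) - gamma a).
Proof.
pose d := Num.min K^-1 (L / 2).
have d0 : 0 < d by rewrite lt_min invr_gt0 K_gt0 divr_gt0.
have dL : d <= L / 2 by rewrite ge_min lexx orbT.
have near_diag a h : 0 <= h <= d -> h <= 2 * enorm (gamma (a + h) - gamma a).
  move=> /andP[h0 hd]; have hK : h <= K^-1 by apply: (le_trans hd); rewrite ge_min lexx.
  have : a <= a <= a + h by rewrite lexx lerDl.
  move=> /(curve_chord_edot_ge derivable_gamma K_gt0 tangent_lip tangent_unit).
  have := edot_le (gamma (a + h) - gamma a) (derive1 gamma a).
  rewrite tangent_unit mulr1 => h1 h2; have {h1 h2} := le_trans h2 h1.
  rewrite (_ : a + h - a = h); last by ring.
  have kh : 0 <= K * h <= 1.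
    by rewrite mulr_ge0 ?(ltW K_gt0) //= mulrC -ler_pdivlMr // mul1r.
  have : (K * h) ^+ 2 <= 1 by case/andP: kh => *; nra.
  move: (_ ^+ 2) => x x1 h2.
  have : h * (1 - x / 2) >= h * 2^-1 by rewrite ler_wpM2l //; lra.
  lra.
have [z zA zmin] : exists2 z, z \in (`[0, L] `*` `[d, L / 2]) &
    forall y, y \in (`[0, L] `*` `[d, L / 2]) -> chord_sqr z <= chord_sqr y.
  apply: compact_EVT_min.
  - by exists (0, d) => /=; rewrite !in_itv /= !lexx (ltW L_gt0) dL.
  - by apply: compact_setX; exact: segment_compact.
  - exact/continuous_subspaceT/chord_sqr_continuous.
move: zA; rewrite inE /= !in_itv /= => -[z1 /andP[z2 z2']].
pose m := enorm (gamma (z.1 + z.2) - gamma z.1).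
have m0 : 0 < m.
  rewrite enorm_gt0 // subr_eq0 curve_neq //; apply/andP; split; lra.
exists (Num.max 2 (L / m)) => [|a h ha /andP[h0 hL]].
  by rewrite lt_max ltr0n.
have [hd|hd] := leP h d.
  apply: (le_trans (near_diag a h _)); first by rewrite h0.
  by rewrite ler_wpM2r ?enorm_ge0 // le_max lexx.
have hm : m <= enorm (gamma (a + h) - gamma a).
  rewrite /m /enorm ler_wsqrtr //; apply: (zmin (a, h)).
  by rewrite inE /= !in_itv /= ha hL (ltW hd).
apply: (@le_trans _ _ (L / m * m)); first by rewrite divfK ?gt_eqF //; lra.
apply: ler_pM => //; first by rewrite divr_ge0 ?ltW.
- exact: ltW.
- by rewrite le_max lexx orbT.
Qed.

(* b' is the representative of b modulo L that is nearest to a. *)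
Lemma close_lift : exists2 C, 0 < C & forall a b, 0 <= a <= L -> 0 <= b <= L ->
  exists b', [/\ gamma b' = gamma b, derive1 gamma b' = derive1 gamma b,
    `|b' - a| <= C * enorm (gamma b - gamma a)
  & Num.min `|b - a| (L - `|b - a|) <= `|b' - a| ].
Proof.
have [C C0 hC] := chord_arc; exists C => // a b ha hb.
have [ha0 haL] := andP ha; have [hb0 hbL] := andP hb.
have gNL s : gamma (s - L) = gamma s by rewrite -(gamma_periodic (s - L)) subrK.
have tNL s : derive1 gamma (s - L) = derive1 gamma s.
  by rewrite -(tangent_periodic (s - L)) subrK.
have [ab|/ltW ba] := leP a b.
  have [h|h] := leP (b - a) (L / 2).
    exists b; split => //; last by rewrite ge_min lexx.
    have := hC a (b - a) ha; rewrite subr_ge0 ab h => /(_ isT).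
    by rewrite [a + _]addrC subrK ger0_norm ?subr_ge0.
  exists (b - L); split => //.
    have h' : 0 <= a + L - b <= L / 2 by apply/andP; split; lra.
    have := hC b _ hb h'; rewrite [b + _]addrC subrK gamma_periodic enormB.
    by rewrite ler0_norm ?opprB //; lra.
  by rewrite ge_min (ger0_norm (_ : 0 <= b - a)) ?subr_ge0 // ler0_norm; lra.
have [h|h] := leP (a - b) (L / 2).
  exists b; split => //; last by rewrite ge_min lexx.
  have := hC b (a - b) hb; rewrite subr_ge0 ba h => /(_ isT).
  by rewrite [b + _]addrC subrK distrC enormB ger0_norm ?subr_ge0.
exists (b + L); split => //; [exact: tangent_periodic| |].
  have h' : 0 <= b + L - a <= L / 2 by apply/andP; split; lra.
  have := hC a _ ha h'; rewrite [a + _]addrC subrK gamma_periodic.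
  by rewrite ger0_norm //; lra.
rewrite ge_min (ler0_norm (_ : b - a <= 0)) ?subr_le0 //.
by rewrite (@ger0_norm _ (b + L - a)); lra.
Qed.

End ClosedCurve.

(** * Boundedness and Lipschitz estimate of the kernel *)

Section KernelEstimates.
Variables (R : realType) (gamma : R -> 'rV[R]_3) (K C L : R).
Hypothesis derivable_gamma : forall s, derivable gamma s 1.
Hypothesis K_gt0 : 0 < K.
Hypothesis tangent_lip : forall s t,
  enorm (derive1 gamma s - derive1 gamma t) <= K * `|s - t|.
Hypothesis tangent_unit : forall s, enorm (derive1 gamma s) = 1.
Hypothesis C_gt0 : 0 < C.
Hypothesis lift : forall a b, 0 <= a <= L -> 0 <= b <= L ->
  exists b', [/\ gamma b' = gamma b, derive1 gamma b' = derive1 gamma b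
    & `|b' - a| <= C * enorm (gamma b - gamma a)].
Implicit Types (s t : R).

Definition curve_kernel s t := tp_kernel (curve_pt gamma s) (gamma t).

Definition defect s t := enorm (perp_part (derive1 gamma s) (gamma t - gamma s)).

Lemma curve_kernelE s t : curve_kernel s t =
  2 * defect s t / enorm (gamma t - gamma s) ^+ 2.
Proof.
exact: (@tp_kernelE R (curve_pt gamma s) (gamma t) (tangent_unit s)).
Qed.

Lemma curve_kernel_ge0 s t : 0 <= curve_kernel s t.
Proof.
by rewrite curve_kernelE divr_ge0 ?sqr_ge0 // mulr_ge0 // enorm_ge0.
Qed.

Lemma tangent_dist_le s t : 0 <= s <= L -> 0 <= t <= L ->
  enorm (derive1 gamma t - derive1 gamma s) <= K * C * enorm (gamma t - gamma s).
Proof.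
move=> hs ht; have [t' [_ <- h]] := lift hs ht.
by apply: (le_trans (tangent_lip _ _)); rewrite -mulrA ler_pM2l.
Qed.

Lemma defect_le_taylor s t : defect s t <= K * (t - s) ^+ 2.
Proof.
apply: le_trans (curve_taylor derivable_gamma K_gt0 tangent_lip s t).
exact: perp_part_min (tangent_unit s).
Qed.

(** Passing to the representative of [t] nearest to [s] leaves [defect] unchanged and bounds the
    parameter distance in the Taylor estimate by the chord. *)
Lemma defect_le s t : 0 <= s <= L -> 0 <= t <= L ->
  defect s t <= K * C ^+ 2 * enorm (gamma t - gamma s) ^+ 2.
Proof.
move=> hs ht; have [t' [gt' _ h]] := lift hs ht.
have := defect_le_taylor s t'; rewrite /defect gt' => /le_trans; apply.
rewrite -mulrA ler_pM2l // -exprMn -[leLHS]real_normK ?num_real //.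
by rewrite ler_sqr ?nnegrE ?normr_ge0 // mulr_ge0 ?enorm_ge0 // ltW.
Qed.

Lemma curve_kernel_le s t : 0 <= s <= L -> 0 <= t <= L ->
  curve_kernel s t <= 2 * K * C ^+ 2.
Proof.
move=> hs ht; rewrite curve_kernelE.
have := enorm_ge0 (gamma t - gamma s); rewrite le_eqVlt => /orP[/eqP <-|w0].
  (* Coinciding points: the quotient is 0 because [0^-1 = 0]. *)
  by rewrite expr0n invr0 mulr0 !mulr_ge0 ?sqr_ge0 // ltW.
rewrite ler_pdivrMr ?exprn_gt0 //.
by have := defect_le hs ht; rewrite -!mulrA => h; rewrite ler_pM2l.
Qed.

(** Every first-order variation carries a chord length. Projecting along the tangent at [s] reduces
    the move from [s] to [s'] to second order; the move from [t] to [t'] keeps only the normal part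
    of its tangent, which is O(|w|); turning the projection costs |w'|. *)
Lemma defect_lip s t s' t' : 0 <= s <= L -> 0 <= t <= L ->
  `|defect s t - defect s' t'| <= K * (`|s - s'| + `|t - t'|)
    * (`|s - s'| + `|t - t'| + C * enorm (gamma t - gamma s)
       + 2 * enorm (gamma t' - gamma s')).
Proof.
move=> hs ht.
have alg x y u u' a1 a2 a3 a4 : 0 <= x -> 0 <= y -> 0 <= u -> 0 <= u' ->
    a1 <= K * x ^+ 2 -> a2 <= K * y ^+ 2 + y * (K * C * u) ->
    a3 <= 2 * K * x * u' -> a4 <= a1 + a2 ->
    a4 + a3 <= K * (x + y) * (x + y + C * u + 2 * u').
  move=> x0 y0 u0 u'0 h1 h2 h3 h4.
  have m1 : 0 <= K * (x * (C * u)) by rewrite !mulr_ge0 // ltW.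
  have m2 : 0 <= K * (y * u') by rewrite !mulr_ge0 // ltW.
  have m3 : 0 <= K * (x * y) by rewrite !mulr_ge0 // ltW.
  lra.
set d := `|_| + _; apply: (le_trans (enorm_rev _ _)).
set w := gamma t - gamma s; set w' := gamma t' - gamma s'.
set T := derive1 gamma s; set T' := derive1 gamma s'.
have -> : perp_part T w - perp_part T' w' =
   perp_part T (gamma s' - gamma s) - perp_part T (gamma t' - gamma t)
   + (perp_part T w' - perp_part T' w').
  by rewrite -perp_partB addrA -perp_partD; congr (perp_part _ _ - _);
    apply/rowP => i; rewrite !mxE; ring.
have h1 : enorm (perp_part T (gamma s' - gamma s)) <= K * `|s - s'| ^+ 2.
  by rewrite distrC real_normK ?num_real //; exact: defect_le_taylor.
have h2 : enorm (perp_part T (gamma t' - gamma t)) <=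
    K * `|t - t'| ^+ 2 + `|t - t'| * (K * C * enorm w).
  rewrite -[gamma t' - gamma t](subrK ((t' - t) *: derive1 gamma t)) perp_partD.
  apply: (le_trans (enormD _ _)); apply: lerD.
    apply: (le_trans (perp_part_le _ (tangent_unit s))).
    rewrite distrC real_normK ?num_real //.
    exact: (curve_taylor derivable_gamma K_gt0 tangent_lip).
  rewrite perp_partZ enormZ distrC ler_wpM2l //.
  apply: le_trans (tangent_dist_le hs ht).
  (* The projection annihilates the tangent at [s], so it may be subtracted from the tangent at [t]
     before taking norms. *)
  rewrite -(perp_part_subr _ (tangent_unit s)).
  exact: perp_part_le (tangent_unit s).
have h3 : enorm (perp_part T w' - perp_part T' w') <= 2 * K * `|s - s'| * enorm w'.
  rewrite perp_part_diff.
  apply: (le_trans (enormD _ _)); rewrite !enormZ tangent_unit mulr1.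
  have k1 := cauchy_schwarz w' T'; have k2 := cauchy_schwarz w' (T' - T).
  rewrite tangent_unit mulr1 in k1.
  have k3 : enorm (T' - T) <= K * `|s - s'| by rewrite distrC; exact: tangent_lip.
  have n0 := enorm_ge0 w'; have n1 := enorm_ge0 (T' - T).
  have k4 : `|edot w' T'| * enorm (T' - T) <= enorm w' * (K * `|s - s'|).
    exact: ler_pM.
  have k5 : enorm w' * enorm (T' - T) <= enorm w' * (K * `|s - s'|).
    exact: ler_pM.
  lra.
apply: (le_trans (enormD _ _)).
have h4 := enormD (perp_part T (gamma s' - gamma s)) (- perp_part T (gamma t' - gamma t)).
rewrite enormN in h4.
apply: alg h1 h2 h3 h4; rewrite ?normr_ge0 ?enorm_ge0 //.
Qed.

(* A kernel of the form N / |w|^2 with N quadratically small is Lipschitz with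
   constant of order 1 / |w|; moving the parameters by more than |w| / 2 is
   covered by boundedness. *)
Lemma curve_kernel_lip : exists2 M, 0 < M & forall s t s' t',
  0 <= s <= L -> 0 <= t <= L -> 0 <= s' <= L -> 0 <= t' <= L ->
  `|curve_kernel s t - curve_kernel s' t'| * enorm (gamma t - gamma s)
    <= M * (`|s - s'| + `|t - t'|).
Proof.
pose A := K * (C + 4); pose B := K * C ^+ 2.
have A0 : 0 < A by rewrite mulr_gt0 // addr_gt0.
have B0 : 0 < B by rewrite mulr_gt0 // exprn_gt0.
exists (2 * A + 5 * B) => [|s t s' t' hs ht hs' ht']; first lra.
set d := `|_| + _.
have d0 : 0 <= d by rewrite addr_ge0.
have := defect_lip s' t' hs ht; rewrite -/d.
have := defect_le hs' ht'; have := curve_kernel_le hs' ht'.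
have := curve_kernel_le hs ht; have := curve_kernel_ge0 s t.
have := curve_kernel_ge0 s' t'.
have xy : `|enorm (gamma t - gamma s) - enorm (gamma t' - gamma s')| <= d.
  apply: (le_trans (enorm_rev _ _)).
  rewrite (_ : _ - _ = (gamma t - gamma t') + (gamma s' - gamma s)); last first.
    by apply/rowP => i; rewrite !mxE; ring.
  apply: (le_trans (enormD _ _)); rewrite addrC /d (distrC s).
  by apply: lerD; exact: (curve_lip derivable_gamma tangent_unit).
have := enorm_ge0 (gamma t' - gamma s'); have := enorm_ge0 (gamma t - gamma s).
move: xy; rewrite !curve_kernelE.
have := enorm_ge0 (perp_part (derive1 gamma s') (gamma t' - gamma s')).
rewrite -/(defect _ _).
move: (enorm (gamma t - gamma s)) (enorm (gamma t' - gamma s')) => x y.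
move: (defect s t) (defect s' t') => N N' N'0.
rewrite ler_norml => /andP[xy1 xy2] x0 y0 k'0 k0 kB k'B N'B NN'.
have [small|big] := leP x (2 * d).
  have : `|2 * N / x ^+ 2 - 2 * N' / y ^+ 2| <= 2 * B.
    by rewrite ler_norml /B; apply/andP; split; lra.
  move=> /(ler_wpM2r x0) /le_trans; apply.
  have : 2 * B * x <= 2 * B * (2 * d) by rewrite ler_wpM2l // mulr_ge0 // ltW.
  have : 0 <= A * d by rewrite mulr_ge0 // ltW.
  have : 0 <= B * d by rewrite mulr_ge0 // ltW.
  lra.
have x1 : 0 < x by lra.
have y1 : 0 < y by lra.
(* Writing N' = k y^2 splits the numerator N - k x^2 into N - N' and k (y^2 - x^2). Since x > 2d,
   one has y <= 3x/2, so d + Cx + 2y <= (C + 4) x and x + y <= 5x/2; this explains the constants 2A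
   + 5B. *)
pose k := N' / y ^+ 2.
have Ek : N' = k * y ^+ 2 by rewrite divfK // expf_neq0 // gt_eqF.
have kp : 0 <= k by rewrite divr_ge0 // sqr_ge0.
have kb : k <= B by rewrite ler_pdivrMr // exprn_gt0.
have e : `|2 * N / x ^+ 2 - 2 * N' / y ^+ 2| * x =
   2 / x * `|N - k * x ^+ 2|.
  transitivity `|(2 * N / x ^+ 2 - 2 * N' / y ^+ 2) * x|.
    by rewrite normrM (gtr0_norm x1).
  transitivity `|2 / x * (N - k * x ^+ 2)|; last first.
    by rewrite normrM (@gtr0_norm _ (2 / x)) // divr_gt0.
  congr `|_|; rewrite /k; field.
  by rewrite !gt_eqF.
rewrite e mulrAC ler_pdivrMr //.
have h1 : `|N - N'| <= A * d * x.
  apply: (le_trans NN'); rewrite /A.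
  rewrite [leRHS](_ : _ = K * d * ((C + 4) * x)); last by ring.
  by rewrite ler_wpM2l ?mulr_ge0 ?(ltW K_gt0) //; lra.
have h2 : `|k * (y ^+ 2 - x ^+ 2)| <= B * (d * (5 / 2 * x)).
  rewrite normrM (ger0_norm kp); apply: ler_pM => //.
  rewrite subr_sqr normrM ; apply: ler_pM => //.
    by rewrite ler_norml; apply/andP; split; lra.
  by rewrite ger0_norm; lra.
have h3 : `|N - k * x ^+ 2| <= A * d * x + B * (d * (5 / 2 * x)).
  rewrite (_ : N - k * x ^+ 2 = (N - N') + k * (y ^+ 2 - x ^+ 2)).
    by apply: (le_trans (ler_normD _ _)); exact: lerD.
  by rewrite Ek; ring.
lra.
Qed.

End KernelEstimates.

(** * Powers and harmonic sums *)

Section RealEstimates.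
Variable R : realType.
Implicit Types (x y q : R) (n : nat).

Lemma powR_lip q (B x y : R) : 1 <= q -> 0 <= x <= B -> 0 <= y <= B ->
  `|x `^ q - y `^ q| <= q * B `^ (q - 1) * `|x - y|.
Proof.
move=> q1; have q0 : 0 < q by apply: lt_le_trans q1.
have qB0 : 0 <= q - 1 by rewrite subr_ge0.
wlog xy : x y / x <= y => [H hx hy|/andP[x0 xB] /andP[y0 yB]].
  have [|/ltW] := leP x y => xy; first exact: H.
  by rewrite distrC (distrC x); exact: H.
rewrite distrC (distrC x) ger0_norm; last first.
  by rewrite subr_ge0; apply: ge0_ler_powR => //; rewrite ?nnegrE // ltW.
rewrite (ger0_norm (_ : 0 <= y - x)) ?subr_ge0 //.
(* The derivative rule is applied at positive points only; for x = 0 the factorisation y^q = y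
   y^(q-1) gives the bound directly. *)
move: x0; rewrite le_eqVlt => /orP[/eqP x0|x0].
  rewrite -x0 powR0 ?gt_eqF // !subr0 -mulr_powRB1 // mulrC ler_wpM2r //.
  apply: (@le_trans _ _ (B `^ (q - 1))).
    by apply: ge0_ler_powR => //; rewrite ?nnegrE // (le_trans y0).
  by rewrite ler_peMl // powR_ge0.
have dp (z : R) : z \in `]x, y[ -> is_derive z 1 (fun t : R => t `^ q) (q * z `^ (q - 1)).
  by rewrite in_itv /= => /andP[xz _]; apply: is_derive1_powR; apply: lt_trans xz.
have [|z] := @MVT_segment R (fun t : R => t `^ q) (fun z => q * z `^ (q - 1)) x y xy dp.
  apply: derivable_within_continuous => z; rewrite in_itv /= => /andP[xz _].
  have ? := is_derive1_powR q (lt_le_trans x0 xz); exact: ex_derive.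
rewrite in_itv /= => /andP[xz zy] ->.
rewrite ler_wpM2r ?subr_ge0 // ler_pM2l //.
by apply: ge0_ler_powR => //; rewrite ?nnegrE ?(le_trans zy) ?(le_trans (ltW x0)) //
  (le_trans y0).
Qed.

Definition harmonic_sum n : R := \sum_(0 <= k < n) (k.+1%:R)^-1.

Lemma harmonic_sum_ge0 n : 0 <= harmonic_sum n.
Proof. by apply: sumr_ge0 => k _; rewrite invr_ge0. Qed.

(** Induction with ln(1 - t) <= -t at t = 1/(n+2), that is 1/(n+2) <= ln(n+2) - ln(n+1). *)
Lemma harmonic_sum_le_ln n : (0 < n)%N -> harmonic_sum n <= 1 + ln n%:R.
Proof.
case: n => // n _; elim: n => [|n IHn].
  by rewrite /harmonic_sum big_nat1 invr1 ln1 addr0.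
rewrite /harmonic_sum big_nat_recr //= -/(harmonic_sum n.+1).
apply: (le_trans (lerD IHn (lexx _))); rewrite -addrA lerD2l.
have n1 : 0 < n.+1%:R :> R by rewrite ltr0n.
have n2 : 0 < n.+2%:R :> R by rewrite ltr0n.
have := @le_ln1Dx R (- (n.+2%:R)^-1).
rewrite ltrN2 invf_lt1 // ltr1n => /(_ isT).
rewrite (_ : 1 + _ = n.+1%:R / n.+2%:R); last first.
  apply: (mulIf (lt0r_neq0 n2)).
  by rewrite mulrDl mul1r mulNr mulVf ?gt_eqF // divfK ?gt_eqF // -natr1 addrK.
rewrite ln_div ?posrE //.
move: (ln n.+1%:R) (ln n.+2%:R) (n.+2%:R^-1) => a b c; lra.
Qed.

(** ln n = ln(n^eps) / eps <= n^eps / eps, and 1 <= n^eps. *)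
Lemma harmonic_sum_le_powR (eps : R) n : 0 < eps -> (0 < n)%N ->
  harmonic_sum n <= (1 + eps^-1) * n%:R `^ eps.
Proof.
move=> e0 n0; apply: (le_trans (harmonic_sum_le_ln n0)); rewrite mulrDl mul1r.
have n1 : 0 < n%:R :> R by rewrite ltr0n.
have n1' : 1 <= n%:R :> R by rewrite ler1n.
apply: lerD.
  by rewrite -[leLHS](powRr0 n%:R) ler_powR // ltW.
rewrite mulrC ler_pdivlMr // mulrC -ln_powR ltW // ln_sublinear //.
exact: powR_gt0.
Qed.

(** With truncated subtraction [(i - j) + (j - i)] is the distance of i and j. Each distance occurs
    at most once on either side of i, whence the factor 2. *)
Lemma sum_dist_le (f : nat -> R) n i : (forall k, 0 <= f k) -> (i < n)%N ->
  \sum_(0 <= j < n | j != i) f ((i - j) + (j - i))%N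
    <= 2 * \sum_(0 <= k < n.-1) f k.+1.
Proof.
move=> f0 lt_in.
have part m : (m <= n.-1)%N ->
    \sum_(0 <= k < m) f k.+1 <= \sum_(0 <= k < n.-1) f k.+1.
  move=> h; rewrite (@big_cat_nat _ _ _ m 0 n.-1) //= lerDl.
  by apply: sumr_ge0 => k _.
rewrite (@big_cat_nat _ _ _ i) //= ?(ltnW lt_in) // [X in _ + X]big_ltn_cond //.
rewrite eqxx /= mulr_natl mulr2n; apply: lerD.
  apply: le_trans (part i _); last by rewrite -ltnS (ltn_predK lt_in).
  rewrite [leLHS]big_mkcond big_nat_rev /= big_nat [leRHS]big_nat.
  apply: ler_sum => j /andP[_ ji]; rewrite add0n.
  case: ifP => // _; rewrite le_eqVlt; apply/orP; left; apply/eqP; congr f.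
  by lia.
apply: le_trans (part (n - i.+1)%N _); last by rewrite -subn1 leq_sub2l.
rewrite [leLHS]big_mkcond -{1}(add0n i.+1) big_addn big_nat [leRHS]big_nat.
apply: ler_sum => j _; case: ifP => // _; rewrite le_eqVlt; apply/orP; left; apply/eqP; congr f.
by lia.
Qed.

Lemma sum_cyclic_dist_le n i : (i < n)%N ->
  \sum_(0 <= j < n | j != i) ((((i - j) + (j - i))%N%:R)^-1
    + (n%:R - ((i - j) + (j - i))%N%:R)^-1) <= 4 * harmonic_sum n :> R.
Proof.
case: n => // n lt_in.
(* The cut-off keeps [f] nonnegative at every natural number, as the previous bound demands; all
   distances that occur lie below it. *)
pose f k : R := if (k <= n.+1)%N then k%:R^-1 + (n.+1%:R - k%:R)^-1 else 0.
have f0 k : 0 <= f k.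
  rewrite /f; case: ifP => // kn.
  by rewrite addr_ge0 // invr_ge0 // -natrB.
rewrite big_nat_cond (eq_bigr (fun j => f ((i - j) + (j - i))%N)); last first.
  by move=> j /andP[/andP[_ jn] _]; rewrite /f ifT //; lia.
rewrite -big_nat_cond; apply: (le_trans (sum_dist_le f0 lt_in)) => /=.
rewrite (_ : 4 = 2 * 2 :> R); last by ring.
rewrite -mulrA ler_pM2l //.
have h : \sum_(0 <= k < n) (k.+1%:R)^-1 <= harmonic_sum n.+1.
  by rewrite /harmonic_sum big_nat_recr //= lerDl invr_ge0.
(* Reversing the order of summation turns the distances the other way round into the direct ones.
   Two sides and two summands give the constant 4. *)
have -> : \sum_(0 <= k < n) f k.+1 =
    \sum_(0 <= k < n) (k.+1%:R)^-1 + \sum_(0 <= k < n) (k.+1%:R)^-1.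
  rewrite [X in _ = _ + X]big_nat_rev -big_split /= big_nat [RHS]big_nat.
  apply: eq_bigr => k /andP[_ kn]; rewrite /f ltnS (ltnW kn) add0n -natrB.
    by congr (_ + _%:R^-1); lia.
  by lia.
by rewrite mulr_natl mulr2n lerD.
Qed.

End RealEstimates.

(** * The double integral as a sum over partition cells *)

Section Cells.
Variable R : realType.
Local Notation mu := (@lebesgue_measure R).
Implicit Types (s : nat -> R) (n : nat).

Lemma measurable_edot d (T : measurableType d) (u v : T -> 'rV[R]_3) :
  (forall j, measurable_fun setT (fun z => u z ord0 j)) ->
  (forall j, measurable_fun setT (fun z => v z ord0 j)) ->
  measurable_fun setT (fun z => edot (u z) (v z)).
Proof.
move=> mu_ mv; under eq_fun do rewrite edotE.
by apply: measurable_funD; first apply: measurable_funD; apply: measurable_funM.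
Qed.

Lemma partition_mono s n : (forall i, (i < n)%N -> s i < s i.+1) ->
  forall i j, (i <= j)%N -> (j <= n)%N -> s i <= s j.
Proof.
move=> s_mono i; elim=> [|j IHj]; first by rewrite leqn0 => /eqP->.
rewrite leq_eqVlt => /orP[/eqP-> //|ij] jn.
by apply: le_trans (ltW (s_mono j jn)); apply: IHj => //; exact: ltnW.
Qed.

Lemma partition_cover s n (x : R) : s 0%N <= x -> x < s n ->
  exists2 i : 'I_n, s i <= x & x < s i.+1.
Proof.
move=> x0; elim: n => [|n IHn] xn; first by have := lt_le_trans xn x0; rewrite ltxx.
have [xn'|nx] := ltP x (s n).
  have [i ? ?] := IHn xn'; by exists (widen_ord (leqnSn n) i).
by exists ord_max.
Qed.

(** Half-open cells tile the half-open square exactly, so no null sets have to be discarded. *)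
Let cell s n (p : 'I_n * 'I_n) : set (R * R) :=
  `[s p.1, s p.1.+1[ `*` `[s p.2, s p.2.+1[.

Lemma square_cells s n : (forall i, (i < n)%N -> s i < s i.+1) ->
  `[s 0%N, s n[ `*` `[s 0%N, s n[ =
  \big[setU/set0]_(p <- index_enum ('I_n * 'I_n)%type) cell s p.
Proof.
move=> s_mono; have mono := partition_mono s_mono.
rewrite -bigcup_seq; apply/seteqP; split => [[x y] /=|[x y] /= [p _]].
  rewrite !in_itv /= => -[/andP[x0 xn] /andP[y0 yn]].
  have [i ix xi] := partition_cover x0 xn.
  have [j jy yj] := partition_cover y0 yn.
  exists (i, j); first by rewrite /= mem_index_enum.
  by rewrite /cell /= !in_itv /= ix xi jy yj.
rewrite /cell /= !in_itv /= => -[/andP[ix xi] /andP[jy yj]].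
split; apply/andP; split.
- by apply: le_trans ix; apply: mono => //; exact: ltnW.
- by apply: (lt_le_trans xi); apply: mono.
- by apply: le_trans jy; apply: mono => //; exact: ltnW.
- by apply: (lt_le_trans yj); apply: mono.
Qed.

Lemma cells_trivIset s n : (forall i, (i < n)%N -> s i < s i.+1) ->
  trivIset [set` index_enum ('I_n * 'I_n)%type] (cell s (n := n)).
Proof.
move=> s_mono; have mono := partition_mono s_mono.
have uniq_idx (i j : 'I_n) x : s i <= x -> x < s i.+1 ->
    s j <= x -> x < s j.+1 -> i = j.
  move=> h1 h2 h3 h4; apply: val_inj => /=; apply/eqP.
  rewrite eqn_leq; apply/andP; split; rewrite leqNgt; apply/negP => h.
    have := le_lt_trans (mono _ _ h (ltnW (ltn_ord i))) (le_lt_trans h1 h4).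
    by rewrite ltxx.
  have := le_lt_trans (mono _ _ h (ltnW (ltn_ord j))) (le_lt_trans h3 h2).
  by rewrite ltxx.
move=> [i j] [i' j'] _ _ [[x y]]; rewrite /cell /= !in_itv /=.
move=> -[[/andP[h1 h2] /andP[h3 h4]] [/andP[h5 h6] /andP[h7 h8]]].
by rewrite (uniq_idx _ _ _ h1 h2 h5 h6) (uniq_idx _ _ _ h3 h4 h7 h8).
Qed.

(** The integrand lies between two step functions. Monotonicity is used for nonnegative functions,
    hence the condition on [a]; finiteness of the integral is a consequence of the upper bound, not
    an assumption. *)
Lemma integral_cells_bounds s n (f : R -> R -> R) (a b : 'I_n -> 'I_n -> R) :
  (forall i, (i < n)%N -> s i < s i.+1) ->
  measurable_fun setT (fun z : R * R => f z.1 z.2) ->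
  (forall x y, 0 <= f x y) -> (forall i j, 0 <= a i j) ->
  (forall (i j : 'I_n) x y, s i <= x < s i.+1 -> s j <= y < s j.+1 ->
     a i j <= f x y <= b i j) ->
  ((\sum_(i < n) \sum_(j < n) a i j * (s i.+1 - s i) * (s j.+1 - s j))%:E
   <= \int[(mu \x mu)%E]_(z in `[s 0%N, s n[ `*` `[s 0%N, s n[) (f z.1 z.2)%:E
   <= (\sum_(i < n) \sum_(j < n) b i j * (s i.+1 - s i) * (s j.+1 - s j))%:E)%E.
Proof.
move=> s_mono mf f0 a0 hab.
have mE D : measurable_fun D (fun z : R * R => (f z.1 z.2)%:E).
  by apply: measurable_funTS; exact/measurable_EFinP.
have mcell (p : 'I_n * 'I_n) : measurable (cell s p).
  by apply: measurableX; exact: measurable_itv.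
have mu_cell (c : R) (p : 'I_n * 'I_n) :
    (\int[(mu \x mu)%E]_(z in cell s p) (cst c%:E) z =
     (c * (s p.1.+1 - s p.1) * (s p.2.+1 - s p.2))%:E)%E.
  rewrite integral_cst; last exact: mcell.
  rewrite [X in (_ * X)%E](_ : _ =
    (mu `[s p.1, s p.1.+1[%classic * mu `[s p.2, s p.2.+1[%classic)%E); last first.
    by apply: product_measure1E; exact: measurable_itv.
  by rewrite !lebesgue_measure_itv /= !lte_fin !s_mono // -!EFinD -!EFinM mulrA.
rewrite (square_cells s_mono) ge0_integral_bigsetU //=; last 4 first.
- exact: index_enum_uniq.
- exact: cells_trivIset.
- exact: mE.
- by move=> z _; exact: (f0 z.1 z.2).
rewrite !pair_bigA /= -!sumEFin; apply/andP; split; apply: lee_sum => p _.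
  rewrite -mu_cell; apply: ge0_le_integral => //=.
  all: try by move=> z _; rewrite lee_fin.
  all: try solve [exact: mE | exact: mcell | exact: measurable_cst].
  move=> [x y]; rewrite /cell /= !in_itv /= => -[hx hy]; rewrite lee_fin.
  by have /andP[] := hab _ _ _ _ hx hy.
rewrite -mu_cell; apply: ge0_le_integral => //=.
all: try by move=> z _; rewrite lee_fin.
all: try solve [exact: mE | exact: mcell | exact: measurable_cst].
all: move=> [x y]; rewrite /cell /= !in_itv /= => -[hx hy]; rewrite lee_fin.
all: have /andP[h1 h2] := hab _ _ _ _ hx hy.
all: by rewrite ?(le_trans (a0 _ _) (le_trans h1 h2)).
Qed.

End Cells.

(** * Measurability of the integrand *)

Section KernelMeasurable.
Variables (R : realType) (gamma : R -> 'rV[R]_3) (K : R).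
Hypothesis derivable_gamma : forall s, derivable gamma s 1.
Hypothesis tangent_lip : forall s t,
  enorm (derive1 gamma s - derive1 gamma t) <= K * `|s - t|.
Hypothesis K_gt0 : 0 < K.
Hypothesis tangent_unit : forall s, enorm (derive1 gamma s) = 1.

Lemma measurable_curve_kernel_powR (q : R) :
  measurable_fun setT (fun z : R * R => curve_kernel gamma z.1 z.2 `^ q).
Proof.
have mg j : measurable_fun setT (fun s => gamma s ord0 j).
  apply: continuous_measurable_fun; exact: (curve_coord_continuous derivable_gamma).
have mt j : measurable_fun setT (fun s => derive1 gamma s ord0 j).
  apply: continuous_measurable_fun; exact: (tangent_coord_continuous K_gt0 tangent_lip).
pose w (z : R * R) := gamma z.2 - gamma z.1.
have mT j : measurable_fun setT (fun z : R * R => derive1 gamma z.1 ord0 j).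
  exact: (measurableT_comp (mt j) measurable_fst).
have mw j : measurable_fun setT (fun z => w z ord0 j).
  under eq_fun do rewrite /w !mxE.
  apply: measurable_funB; first exact: (measurableT_comp (mg j) measurable_snd).
  exact: (measurableT_comp (mg j) measurable_fst).
pose p (z : R * R) := perp_part (derive1 gamma z.1) (w z).
have mp j : measurable_fun setT (fun z => p z ord0 j).
  rewrite (_ : (fun z => _) = fun z => w z ord0 j
    - edot (w z) (derive1 gamma z.1) * derive1 gamma z.1 ord0 j); last first.
    by apply/funext => z; rewrite /p /perp_part !mxE.
  apply: measurable_funB; first exact: mw.
  apply: measurable_funM; last exact: mT.
  exact: measurable_edot.
(* Root and inverse become real powers of inner products. At a zero base the power -1 is 0, like
   [0^-1], so the identity holds on the diagonal too. *)
rewrite (_ : (fun z => _) = fun z =>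
  (2 * edot (p z) (p z) `^ (2^-1) * edot (w z) (w z) `^ (-1)) `^ q); last first.
  apply/funext => z; congr (_ `^ q).
  rewrite (curve_kernelE tangent_unit) powR12_sqrt ?edot_ge0 //.
  by rewrite powR_inv1 ?edot_ge0 // enorm_sqr.
have mpow r (h : R * R -> R) : measurable_fun setT h ->
    measurable_fun setT (fun z => h z `^ r).
  by move=> mh; have := measurableT_comp (@measurable_powR R r) mh; apply.
apply: (mpow q); apply: measurable_funM; last exact: (mpow _ _ (measurable_edot _ _)).
by apply: measurable_funM => //; exact: (mpow _ _ (measurable_edot _ _)).
Qed.

End KernelMeasurable.

(** * Summing the quadrature errors *)

Section QuadratureSum.
Variables (R : realType) (n : nat) (F : 'I_n -> 'I_n -> R) (h l : 'I_n -> R).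
Variables (P D c e : R).
Hypothesis n_gt0 : (0 < n)%N.
Hypotheses (P_ge0 : 0 <= P) (D_ge0 : 0 <= D) (c_ge0 : 0 <= c) (e_ge0 : 0 <= e).
Hypothesis F_bounds : forall i j, 0 <= F i j <= P.
Hypothesis h_bounds : forall i, 0 <= h i <= c / n%:R.
Hypothesis l_close : forall i, `|l i - h i| <= e / n%:R ^+ 2.

(** The two inverses belong to the two ways round the circle; their sum dominates the inverse of the
    cyclic distance and avoids a minimum in the summation. On the diagonal only boundedness is
    available. *)
Definition oscillation (m i j : nat) : R :=
  if j == i then P else
    D * ((((i - j) + (j - i))%N%:R)^-1 + (m%:R - ((i - j) + (j - i))%N%:R)^-1).

Lemma oscillation_ge0 (i j : 'I_n) : 0 <= oscillation n i j.
Proof.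
rewrite /oscillation; case: ifP => // _; rewrite mulr_ge0 // addr_ge0 // invr_ge0 //.
by rewrite subr_ge0 ler_nat; have := ltn_ord i; have := ltn_ord j; lia.
Qed.

Let N : R := n%:R.
Let N_gt0 : 0 < N. Proof. by rewrite ltr0n. Qed.
Let N_ge1 : 1 <= N. Proof. by rewrite ler1n. Qed.

Lemma sum_oscillation_le : \sum_(i < n) \sum_(j < n) oscillation n i j * h i * h j
  <= c ^+ 2 * (P + 4 * D * harmonic_sum R n) / N.
Proof.
have row (i : 'I_n) : \sum_(j < n) oscillation n i j <= P + 4 * D * harmonic_sum R n.
  rewrite (bigD1 i) //= {1}/oscillation eqxx lerD2l.
  have := ler_wpM2l D_ge0 (sum_cyclic_dist_le R (ltn_ord i)).
  rewrite (_ : D * (4 * _) = 4 * D * harmonic_sum R n); last by ring.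
  apply: le_trans; rewrite big_mkord mulr_sumr le_eqVlt; apply/orP; left; apply/eqP.
  by apply: eq_big => // j ji; rewrite /oscillation ifN.
apply: (@le_trans _ _ (\sum_(i < n) (P + 4 * D * harmonic_sum R n) * (c / N) ^+ 2)).
  apply: ler_sum => i _; apply: le_trans (ler_wpM2r (sqr_ge0 _) (row i)).
  rewrite mulr_suml; apply: ler_sum => j _.
  have /andP[hi0 hi] := h_bounds i; have /andP[hj0 hj] := h_bounds j.
  rewrite -mulrA expr2; apply: ler_wpM2l; first exact: oscillation_ge0.
  exact: ler_pM.
rewrite sumr_const card_ord -mulr_natr -/N le_eqVlt; apply/orP; left; apply/eqP.
by field; rewrite gt_eqF.
Qed.

(** Exchanging one length at a time changes each of the n^2 terms by O(n^-3): a length error e/n^2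
    times a length of order 1/n. *)
Lemma sum_length_diff_le :
  `|\sum_(i < n) \sum_(j < n) F i j * h i * h j
    - \sum_(i < n) \sum_(j < n) F i j * l i * l j| <= P * e * (2 * c + e) / N.
Proof.
rewrite -sumrB; apply: (le_trans (ler_norm_sum _ _ _)).
apply: (@le_trans _ _ (\sum_(i < n) \sum_(j < n) P * e * (2 * c + e) / N ^+ 3)).
  apply: ler_sum => i _; rewrite -sumrB; apply: (le_trans (ler_norm_sum _ _ _)).
  apply: ler_sum => j _.
  have /andP[hi0 hi] := h_bounds i; have /andP[hj0 hj] := h_bounds j.
  have /andP[F0 FP] := F_bounds i j.
  have li := l_close i; have lj := l_close j.
  rewrite -/N in hi hj li lj.
  have eN : e / N ^+ 2 <= e / N.
    rewrite ler_wpM2l // lef_pV2 ?posrE ?exprn_gt0 // expr2.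
    by rewrite -[leLHS]mulr1 ler_pM2l.
  have li' : `|l i| <= (c + e) / N.
    rewrite -[l i](subrK (h i)); apply: (le_trans (ler_normD _ _)).
    by rewrite (ger0_norm hi0) mulrDl addrC lerD // (le_trans li).
  have -> : F i j * h i * h j - F i j * l i * l j =
    - F i j * ((l i - h i) * h j + l i * (l j - h j)) by ring.
  rewrite normrM normrN (ger0_norm F0).
  rewrite [leRHS](_ : _ = P * (e / N ^+ 2 * (c / N) + (c + e) / N * (e / N ^+ 2))); last first.
    by field; rewrite gt_eqF.
  apply: ler_pM => //; apply: (le_trans (ler_normD _ _)); rewrite !normrM.
  rewrite (ger0_norm hj0); apply: lerD; exact: ler_pM.
rewrite !sumr_const card_ord -mulrnA -[_ *+ (n * n)]mulr_natr natrM -/N le_eqVlt; apply/orP; left; apply/eqP.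
by field; rewrite gt_eqF.
Qed.

Lemma quadrature_error_le (T : R) :
  \sum_(i < n) \sum_(j < n) Num.max 0 (F i j - oscillation n i j) * h i * h j <= T ->
  T <= \sum_(i < n) \sum_(j < n) (F i j + oscillation n i j) * h i * h j ->
  `|T - \sum_(i < n) \sum_(j < n) F i j * l i * l j|
    <= (c ^+ 2 * P + P * e * (2 * c + e) + 4 * c ^+ 2 * D) * (1 + harmonic_sum R n) / N.
Proof.
move=> Tlo Thi.
(* Removing the truncation at 0 only lowers the left-hand side. *)
have hlo : \sum_(i < n) \sum_(j < n) F i j * h i * h j
    - \sum_(i < n) \sum_(j < n) oscillation n i j * h i * h j <= T.
  apply: le_trans Tlo; rewrite -sumrB; apply: ler_sum => i _.
  rewrite -sumrB; apply: ler_sum => j _.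
  have /andP[hi0 hi] := h_bounds i; have /andP[hj0 hj] := h_bounds j.
  rewrite -!mulrBl !ler_wpM2r // le_max lexx orbT //.
have hhi : T <= \sum_(i < n) \sum_(j < n) F i j * h i * h j
    + \sum_(i < n) \sum_(j < n) oscillation n i j * h i * h j.
  apply: (le_trans Thi); rewrite -big_split; apply: ler_sum => i _ /=.
  by rewrite -big_split; apply: ler_sum => j _ /=; rewrite -!mulrDl.
have h1 := sum_oscillation_le; have h2 := sum_length_diff_le.
have H0 := harmonic_sum_ge0 R n.
have h3 : c ^+ 2 * (P + 4 * D * harmonic_sum R n) / N + P * e * (2 * c + e) / N <=
  (c ^+ 2 * P + P * e * (2 * c + e) + 4 * c ^+ 2 * D) * (1 + harmonic_sum R n) / N.
  rewrite -mulrDl ler_pM2r ?invr_gt0 //.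
  have m1 : 0 <= c ^+ 2 * P * harmonic_sum R n by rewrite !mulr_ge0 ?sqr_ge0.
  have m2 : 0 <= c ^+ 2 * D by rewrite !mulr_ge0 ?sqr_ge0.
  have m3 : 0 <= P * e * c by rewrite !mulr_ge0.
  have m4 : 0 <= P * e * e by rewrite !mulr_ge0.
  have m5 : 0 <= P * e * c * harmonic_sum R n by rewrite !mulr_ge0.
  have m6 : 0 <= P * e * e * harmonic_sum R n by rewrite !mulr_ge0.
  lra.
move: h1 h2 hlo hhi h3.
set S := \sum_(i < n) _; set O := \sum_(i < n) _; set E := \sum_(i < n) _.
move: (_ / N) (_ / N) (_ / N) => a b d h1; rewrite !ler_norml => /andP[h2 h3] h4 h5 h6.
by apply/andP; split; lra.
Qed.

End QuadratureSum.

(** * Combining geometry and quadrature *)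

Section Assembly.
Variable R : realType.
Implicit Types gamma : R -> 'rV[R]_3.

(** The balance condition supplies its own parameters, but both point-tangent pairs are read off the
    same biarc and hence coincide. The biarc bound then applies with [eta] = K (t - s), and chord
    and parameter length differ by a third-order term. *)
Lemma balanced_biarc_len gamma (K s t : R) (b : biarc R) :
  (forall s, derivable gamma s 1) -> 0 < K ->
  (forall s t, enorm (derive1 gamma s - derive1 gamma t) <= K * `|s - t|) ->
  (forall s, enorm (derive1 gamma s) = 1) ->
  s <= t -> K * (t - s) <= 10^-1 ->
  interpolates b (curve_pt gamma s) (curve_pt gamma t) ->
  gamma_interpolating_balanced gamma b ->
  `|biarc_len b - (t - s)| <= 10 * K * (t - s) ^+ 2.
Proof.
move=> dg K0 lip unit st small hb [s0 [h0 [_ hb0 hS bal]]].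
have [es et] : curve_pt gamma s0 = curve_pt gamma s /\
    curve_pt gamma (s0 + h0) = curve_pt gamma t.
  by case: hb hb0 => _ [_ _ <- _ <-] [_ [_ _ <- _ <-]].
rewrite es et in hS.
have [eps ept] : gamma s0 = gamma s /\ gamma (s0 + h0) = gamma t.
  by case: es et => -> _ [-> _].
rewrite eps ept in bal.
have h_ge0 : 0 <= t - s by rewrite subr_ge0.
have eta0 : 0 <= K * (t - s) by rewrite mulr_ge0 // ltW.
have := curve_chord_edot_ge dg K0 lip unit (_ : s <= s <= t).
rewrite lexx st => /(_ isT) hx.
have := curve_chord_edot_ge dg K0 lip unit (_ : s <= t <= t).
rewrite lexx st => /(_ isT) hy.
have d_le := curve_lip_le dg unit st.
have d_ge : (t - s) * (1 - (K * (t - s)) ^+ 2 / 2) <= enorm (gamma t - gamma s).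
  by apply: (le_trans hx); rewrite (le_trans (edot_le _ _)) // unit mulr1.
have sq : (1 - (K * (t - s)) ^+ 2) * enorm (gamma t - gamma s)
    <= (t - s) * (1 - (K * (t - s)) ^+ 2 / 2).
  move: (enorm _) (t - s) (sqr_ge0 (K * (t - s))) d_le h_ge0 eta0 small => d h.
  move: (K * h) => eta eta2 dh hh e0 e1; clear - eta2 dh hh e0 e1.
  have e2 : eta ^+ 2 <= 1 by nra.
  nra.
have /andP[len_ge len_le] := biarc_len_bounds eta0 small hb hS bal
  (le_trans sq hx) (le_trans sq hy).
move: len_ge len_le d_le d_ge h_ge0 eta0 small.
rewrite (_ : 10 * K * (t - s) ^+ 2 = 10 * (K * (t - s)) * (t - s)); last by ring.
rewrite [pos _]/= [pos _]/=.
move: (biarc_len b) (enorm _) (t - s) => l d h.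
move: (K * h) => eta h1 h2 h3 h4 hh e0 e1; clear - h1 h2 h3 h4 hh e0 e1.
rewrite ler_norml; apply/andP; split; last first.
  have : (1 + 10 * eta) * d <= (1 + 10 * eta) * h by rewrite ler_wpM2l //; lra.
  lra.
have : h * eta ^+ 2 <= h * eta by rewrite ler_wpM2l //; nra.
have : 0 <= h * eta by rewrite mulr_ge0.
lra.
Qed.

Lemma partition_dist_ge (s : nat -> R) n (a : R) : (forall i, (i < n)%N -> a <= s i.+1 - s i) ->
  forall i j, (i <= j)%N -> (j <= n)%N -> (j - i)%:R * a <= s j - s i.
Proof.
move=> ha i; elim=> [|j IHj]; first by rewrite leqn0 => /eqP->; rewrite subnn mul0r subrr.
rewrite leq_eqVlt => /orP[/eqP<-|ij jn]; first by rewrite subnn mul0r subrr.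
rewrite subSn // -natr1 mulrDl mul1r.
by have := IHj ij (ltnW jn); have := ha j jn; lra.
Qed.

(** The way round from the later index consists of the gaps up to n and those from 0 to the earlier
    index, n - d in all. *)
Lemma partition_cyclic_dist_ge (s : nat -> R) n (a : R) (i j : nat) :
  (forall i, (i < n)%N -> a <= s i.+1 - s i) -> 0 <= a -> (i < n)%N -> (j < n)%N ->
  let d := ((i - j) + (j - i))%N in
  d%:R * a <= `|s j - s i| /\ (n - d)%:R * a <= s n - s 0%N - `|s j - s i|.
Proof.
move=> ha a0.
wlog ij : i j / (i <= j)%N => [H hi hj|hi hj].
  have [|/ltnW] := leqP i j => ij; first exact: H.
  by rewrite addnC distrC; exact: H.
have dist := partition_dist_ge ha.
have -> : ((i - j) + (j - i) = j - i)%N by lia.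
have h1 := dist _ _ ij (ltnW hj).
have h2 := dist _ _ (ltnW hj) (leqnn n).
have h3 := dist _ _ (leq0n i) (ltnW hi).
have h0 : 0 <= s j - s i by apply: le_trans h1; rewrite mulr_ge0.
rewrite (ger0_norm h0); split=> //.
rewrite (_ : (n - (j - i) = (n - j) + (i - 0))%N); last by lia.
by rewrite natrD mulrDl; lra.
Qed.

Lemma index_dist_bounds (n i j : nat) : (i < n)%N -> (j < n)%N -> j != i ->
  (0 < (i - j) + (j - i) < n)%N.
Proof. lia. Qed.

(** In the application u is a kernel difference, w the chord between two nodes, X and Y the two
    parameter distances between them, x and y the index distances and a the minimal gap. Whichever
    of X and Y is smaller, the inverse of its index distance appears in the sum. *)
Lemma inverse_distance_bound (u w E C X Y a x y : R) :
  0 <= u -> 0 < a -> 0 < C -> 0 < x -> 0 < y -> 0 <= E ->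
  u * w <= E -> Num.min X Y <= C * w -> x * a <= X -> y * a <= Y ->
  u <= C * E / a * (x^-1 + y^-1).
Proof.
move=> u0 a0 C0 x0 y0 E0 uw XY hX hY.
have D0 : 0 <= C * E / a by rewrite divr_ge0 ?mulr_ge0 // ltW.
have key z : 0 < z -> z * a <= C * w -> u <= C * E / a * z^-1.
  move=> z0 zw; rewrite ler_pdivlMr // ler_pdivlMr // -mulrA.
  apply: (le_trans (ler_wpM2l u0 zw)).
  by rewrite mulrCA ler_pM2l.
rewrite mulrDr; have [h|h] := leP X Y.
  apply: (le_trans (key x x0 _)); last by rewrite lerDl mulr_ge0 // invr_ge0 ltW.
  by apply: (le_trans hX); move: XY; rewrite min_l.
apply: (le_trans (key y y0 _)); last by rewrite lerDr mulr_ge0 // invr_ge0 ltW.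
by apply: (le_trans hY); move: XY; rewrite min_r // ltW.
Qed.

Lemma distributed_gap (L c1 c2 : R) n0 (s : nat -> nat -> R) n i :
  distributed L c1 c2 n0 s -> (n0 <= n)%N -> (i < n)%N ->
  c1 / n%:R <= s n i.+1 - s n i <= c2 / n%:R.
Proof.
move=> sd n0n lt_in; have [_ _ s_mono [h1 _ h2 _]] := sd n n0n.
have gapE : gap (s n) i = s n i.+1 - s n i.
  by rewrite /gap gtr0_norm // subr_gt0 s_mono.
apply/andP; split.
  apply: (le_trans h1); rewrite -gapE /min_gap.
  exact: (bigmin_le _ (Ordinal lt_in) (fun k : 'I_n => gap (s n) k)).
apply: le_trans h2; rewrite -gapE /mesh.
exact: (le_bigmax _ (fun k : 'I_n => gap (s n) k) (Ordinal lt_in)).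
Qed.

End Assembly.

(** The estimate before eps enters: the harmonic sum is kept, so one N and one A serve every eps. *)
Lemma quadrature_bound (R : realType) (q L c1 c2 : R) (gamma : R -> 'rV[R]_3)
    (n0 : nat) (s : nat -> nat -> R) (beta : nat -> biarc_curve R) :
  1 <= q -> 0 < L -> 0 < c1 -> 0 < c2 -> closed_C11_ia L gamma -> (0 < n0)%N ->
  distributed L c1 c2 n0 s ->
  (forall n, (n0 <= n)%N -> closed_biarc_curve n (beta n)) ->
  (forall n, (n0 <= n)%N -> gamma_interpolating_balanced_curve gamma n (beta n)) ->
  (forall n i, (n0 <= n)%N -> (i <= n)%N -> node (beta n) i = curve_pt gamma (s n i)) ->
  exists N A, [/\ (n0 <= N)%N, 0 < A & forall n, (N <= n)%N ->
    (`| TP q L gamma - (discrete_energy q n (beta n))%:E |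
      <= (A * (1 + harmonic_sum R n) / n%:R)%:E)%E].
Proof.
move=> q1 L0 c10 c20 [per dg [K0 lip0] unit inj] n0_gt0 sd closed bal data.
have slack (X H N : R) : 0 <= H -> 0 <= N ->
    X * (1 + H) / N <= (X + 1) * (1 + H) / N.
  move=> H0 N0; rewrite ler_wpM2r ?invr_ge0 // ler_wpM2r ?addr_ge0 //.
  by rewrite lerDl.
have q0 : 0 < q by exact: lt_le_trans q1.
pose K := Num.max K0 1.
have K_gt0 : 0 < K by rewrite lt_max ltr01 orbT.
have lip a b : enorm (derive1 gamma a - derive1 gamma b) <= K * `|a - b|.
  by apply: (le_trans (lip0 a b)); rewrite ler_wpM2r // le_max lexx.
have [C C0 lift4] := close_lift L0 per inj dg K_gt0 lip unit.
have lift a b : 0 <= a <= L -> 0 <= b <= L ->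
    exists b', [/\ gamma b' = gamma b, derive1 gamma b' = derive1 gamma b
      & `|b' - a| <= C * enorm (gamma b - gamma a)].
  by move=> ha hb; have [b' [h1 h2 h3 _]] := lift4 a b ha hb; exists b'.
have chord_ge a b : 0 <= a <= L -> 0 <= b <= L ->
    Num.min `|b - a| (L - `|b - a|) <= C * enorm (gamma b - gamma a).
  by move=> ha hb; have [b' [_ _ h3 h4]] := lift4 a b ha hb; exact: le_trans h4 h3.
have [M M0 klip] := curve_kernel_lip dg K_gt0 lip unit C0 lift.
pose B := 2 * K * C ^+ 2; pose P := B `^ q.
(* q B^(q-1) is the Lipschitz constant of the power, 2 c2 / n bounds the displacement within a cell,
   and C / (c1 / n) converts chords to index distances; the factors n cancel. *)
pose D := q * B `^ (q - 1) * (C * (M * (2 * c2)) / c1).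
pose e := 10 * K * c2 ^+ 2.
pose k := curve_kernel gamma.
have B0 : 0 <= B by rewrite !mulr_ge0 ?sqr_ge0 // ltW.
have P0 : 0 <= P by exact: powR_ge0.
have D0 : 0 <= D.
  by rewrite !mulr_ge0 ?powR_ge0 ?invr_ge0 ?(ltW q0) ?(ltW C0) ?(ltW M0) ?(ltW c20) ?(ltW c10).
have e0 : 0 <= e by rewrite !mulr_ge0 ?sqr_ge0 // ltW.
have k_bd a b : 0 <= a <= L -> 0 <= b <= L -> 0 <= k a b <= B.
  move=> ha hb; rewrite curve_kernel_ge0 //=.
  exact: (curve_kernel_le dg K_gt0 lip unit C0 lift).
have kq_bd a b : 0 <= a <= L -> 0 <= b <= L -> 0 <= k a b `^ q <= P.
  move=> ha hb; have /andP[h1 h2] := k_bd a b ha hb.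
  by rewrite powR_ge0 /=; apply: ge0_ler_powR; rewrite ?nnegrE ?(ltW q0).
(* The default value 0 on the diagonal lets the full double sum agree with the one over j != i. *)
have kdiag a : k a a `^ q = 0.
  rewrite /k (curve_kernelE unit) subrr enorm0 expr0n invr0 mulr0.
  by rewrite powR0 // gt_eqF.
(* Beyond this index K c2 / n <= 1/10, the smallness required for the biarc lengths. *)
exists (maxn n0 (Num.bound (10 * K * c2))).
exists (c2 ^+ 2 * P + P * e * (2 * c2 + e) + 4 * c2 ^+ 2 * D + 1); split.
- exact: leq_maxl.
- have c2_ge0 := ltW c20.
  have h1 : 0 <= c2 ^+ 2 * P by rewrite mulr_ge0 // sqr_ge0.
  have h2 : 0 <= P * e * (2 * c2 + e).
    by rewrite mulr_ge0 ?addr_ge0 // mulr_ge0.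
  have h3 : 0 <= 4 * c2 ^+ 2 * D by rewrite mulr_ge0 // mulr_ge0 // sqr_ge0.
  by rewrite ltr_wpDl // addr_ge0 // addr_ge0.
move=> n; rewrite geq_max => /andP[n0n nbig].
have n_gt0 : (0 < n)%N by exact: leq_trans n0n.
have N0 : 0 < n%:R :> R by rewrite ltr0n.
have [s0 sL s_mono _] := sd n n0n.
have gaps i : (i < n)%N -> c1 / n%:R <= s n i.+1 - s n i <= c2 / n%:R.
  exact: distributed_gap sd n0n.
have s_in i : (i <= n)%N -> 0 <= s n i <= L.
  by move=> lein; rewrite -s0 -[L]sL; apply/andP; split; apply: (partition_mono s_mono).
pose h (i : 'I_n) := s n i.+1 - s n i; pose l (i : 'I_n) := biarc_len (arcs (beta n) i).
have h_bd i : 0 <= h i <= c2 / n%:R.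
  by rewrite subr_ge0 (ltW (s_mono _ _)) //=; have /andP[] := gaps i (ltn_ord i).
have l_bd i : `|l i - h i| <= e / n%:R ^+ 2.
  have /andP[hi0 hi] := h_bd i.
  have small : K * h i <= 10^-1.
    apply: (@le_trans _ _ (K * (c2 / n%:R))); first by rewrite ler_pM2l.
    rewrite mulrA ler_pdivrMr // ler_pdivlMl // mulrA.
    apply: (le_trans (ltW (archi_boundP _))); last by rewrite ler_nat.
    by rewrite !mulr_ge0 // ltW.
  have hb := (closed n n0n).1 i (ltn_ord i).
  rewrite data ?(ltnW (ltn_ord i)) // data // in hb.
  have := balanced_biarc_len dg K_gt0 lip unit (ltW (s_mono i (ltn_ord i))) small hb
    (bal n n0n i (ltn_ord i)).
  move=> /le_trans; apply; rewrite /e -[_ / _]mulrA -expr_div_n -/(h i).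
  by rewrite ler_pM2l ?mulr_gt0 // ler_sqr ?nnegrE // divr_ge0 // (ltW c20).
pose F (i j : 'I_n) := k (s n i) (s n j) `^ q.
have F_bd i j : 0 <= F i j <= P by apply: kq_bd; apply: s_in; exact: ltnW.
have cell_in (i : 'I_n) x : s n i <= x < s n i.+1 -> 0 <= x <= L.
  move=> /andP[ix xi]; have /andP[h1 _] := s_in i (ltnW (ltn_ord i)).
  by have /andP[_ h2] := s_in i.+1 (ltn_ord i); rewrite (le_trans h1) //= (le_trans (ltW xi)).
have osc (i j : 'I_n) x y : s n i <= x < s n i.+1 -> s n j <= y < s n j.+1 ->
    `|k x y `^ q - F i j| <= oscillation P D n i j.
  move=> hx hy; have xL := cell_in _ _ hx; have yL := cell_in _ _ hy.
  rewrite /oscillation; case: ifPn => [/eqP/val_inj ji|ji].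
    rewrite /F ji kdiag subr0 ger0_norm ?powR_ge0 //.
    by have /andP[] := kq_bd x y xL yL.
  have iL := s_in i (ltnW (ltn_ord i)); have jL := s_in j (ltnW (ltn_ord j)).
  apply: (le_trans (powR_lip q1 (k_bd _ _ xL yL) (k_bd _ _ iL jL))).
  rewrite /D -[leRHS]mulrA; apply: ler_wpM2l; first by rewrite mulr_ge0 ?powR_ge0 ?(ltW q0).
  have gap_ge i0 : (i0 < n)%N -> c1 / n%:R <= s n i0.+1 - s n i0.
    by move=> /gaps/andP[].
  have a0 : 0 < c1 / n%:R by rewrite divr_gt0.
  have [X1 X2] := partition_cyclic_dist_ge gap_ge (ltW a0) (ltn_ord i) (ltn_ord j).
  set d := (i - j + (j - i))%N in X1 X2 *.
  have /andP[d0 dn] : (0 < d < n)%N by exact: index_dist_bounds.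
  rewrite s0 sL subr0 in X2.
  have E0 : 0 <= M * (2 * c2 / n%:R) by rewrite !mulr_ge0 ?invr_ge0 // ltW.
  have uw : `|k x y - k (s n i) (s n j)| * enorm (gamma (s n j) - gamma (s n i))
      <= M * (2 * c2 / n%:R).
    rewrite distrC; apply: (le_trans (klip _ _ _ _ iL jL xL yL)).
    rewrite ler_pM2l //.
    have /andP[_ hi] := h_bd i; have /andP[_ hj] := h_bd j.
    move: hx hy hi hj => /andP[x1 x2] /andP[y1 y2]; rewrite /h => hi hj.
    rewrite (distrC _ x) (distrC _ y) !ger0_norm ?subr_ge0 //.
    rewrite [leRHS](_ : _ = c2 / n%:R + c2 / n%:R); last by field; rewrite gt_eqF.
    by apply: lerD; [apply: le_trans hi|apply: le_trans hj]; rewrite lerD2r ltW.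
  have d0R : 0 < d%:R :> R by rewrite ltr0n.
  have dnR : 0 < (n - d)%:R :> R by rewrite ltr0n subn_gt0.
  have := inverse_distance_bound (normr_ge0 _) a0 C0 d0R dnR E0 uw
    (chord_ge _ _ iL jL) X1 X2.
  rewrite (natrB _ (ltnW dn)).
  rewrite (_ : C * (M * (2 * c2 / n%:R)) / (c1 / n%:R) = C * (M * (2 * c2)) / c1) //.
  by field; rewrite !gt_eqF.
have energyE : discrete_energy q n (beta n) =
    \sum_(i < n) \sum_(j < n) F i j * l i * l j.
  (* The discrete energy takes the tangent at the inner index, [F] at its first one. *)
  rewrite [RHS]exchange_big; apply: eq_bigr => i _.
  rewrite [RHS](bigD1 i) //= {1}/F kdiag !mul0r add0r; apply: eq_bigr => j _.
  rewrite !data ?(ltnW (ltn_ord _)) // mulrAC; congr (_ * _).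
have mf : measurable_fun setT (fun z : R * R => k z.1 z.2 `^ q).
  exact: (measurable_curve_kernel_powR dg lip K_gt0 unit).
have := @integral_cells_bounds R (s n) n (fun x y => k x y `^ q)
  (fun i j => Num.max 0 (F i j - oscillation P D n i j))
  (fun i j => F i j + oscillation P D n i j) s_mono mf
  (fun x y => powR_ge0 _ _).
rewrite s0 sL -/(TP q L gamma) => /(_ _ _)/andP[].
- by move=> i j; rewrite le_max lexx.
- move=> i j x y hx hy; have := osc i j x y hx hy.
  rewrite ler_norml => /andP[h1 h2]; rewrite ge_max powR_ge0 /=.
  by apply/andP; split; lra.
move=> lo hi.
have TPge0 : (0 <= TP q L gamma)%E.
  apply: le_trans lo; rewrite lee_fin; apply: sumr_ge0 => i _; apply: sumr_ge0 => j _.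
  have /andP[hi0 _] := h_bd i; have /andP[hj0 _] := h_bd j.
  by rewrite mulr_ge0 // mulr_ge0 // le_max lexx.
have TPfin : TP q L gamma \is a fin_num.
  by rewrite (ge0_fin_numE TPge0); exact: le_lt_trans hi (ltry _).
move: lo hi; rewrite -(fineK TPfin) !lee_fin => lo hi.
rewrite energyE.
have err := quadrature_error_le n_gt0 P0 D0 (ltW c20) e0 F_bd h_bd l_bd lo hi.
exact: le_trans err (slack _ _ _ (harmonic_sum_ge0 R n) (ltW N0)).
Qed.

Theorem theorem3p1 (R : realType) (q L c1 c2 : R) (gamma : R -> 'rV[R]_3)
    (n0 : nat) (s : nat -> nat -> R) (beta : nat -> biarc_curve R)
    (q_ge2 : 2 <= q) (L_gt0 : 0 < L) (c1_gt0 : 0 < c1) (c2_gt0 : 0 < c2)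
    (gamma_C11 : closed_C11_ia L gamma)
    (n0_ge2 : (2 <= n0)%N)
    (s_distr : distributed L c1 c2 n0 s)
    (beta_closed : forall n, (n0 <= n)%N -> closed_biarc_curve n (beta n))
    (beta_proper : forall n, (n0 <= n)%N -> proper_biarc_curve n (beta n))
    (beta_balanced : forall n, (n0 <= n)%N ->
       gamma_interpolating_balanced_curve gamma n (beta n))
    (beta_data : forall n i, (n0 <= n)%N -> (i <= n)%N ->
       node (beta n) i = curve_pt gamma (s n i)) :
  exists N : nat, (n0 <= N)%N /\
    forall eps : R, 0 < eps ->
      exists C : R, 0 < C /\
        forall n : nat, (N <= n)%N ->
          (`| TP q L gamma - (discrete_energy q n (beta n))%:E |
             <= (C / n%:R `^ (1 - eps))%:E)%E.
Proof.
have q_ge1 : 1 <= q by lra.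
have [N [A [n0N A0 bound]]] := quadrature_bound q_ge1 L_gt0 c1_gt0 c2_gt0 gamma_C11
  (ltnW n0_ge2) s_distr beta_closed beta_balanced beta_data.
(* 1 + H <= n^eps + (1 + 1/eps) n^eps, with H the harmonic sum. *)
exists N; split=> // eps eps0; exists (A * (2 + eps^-1)).
have e_inv : 0 < eps^-1 by rewrite invr_gt0.
split; first by rewrite mulr_gt0 // addr_gt0.
move=> n Nn; apply: (le_trans (bound n Nn)); rewrite lee_fin.
have n_gt0 : (0 < n)%N by exact: leq_trans (ltnW n0_ge2) (leq_trans n0N Nn).
have n0R : 0 < n%:R :> R by rewrite ltr0n.
have pe : 1 <= n%:R `^ eps by rewrite -[leLHS](powRr0 n%:R) ler_powR ?ler1n // ltW.
have -> : n%:R `^ (1 - eps) = n%:R / n%:R `^ eps.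
  by rewrite powRB ?(gt_eqF n0R) ?implybT // powRr1 // ler0n.
rewrite invf_div mulrA.
rewrite ler_pM2r ?invr_gt0 // -mulrA ler_pM2l //.
have := harmonic_sum_le_powR eps0 n_gt0.
by rewrite (_ : (2 + _) * _ = n%:R `^ eps + (1 + eps^-1) * n%:R `^ eps); [lra|ring].
Qed.
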